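(* Let $0<\beta<\alpha<\mu\le1$ and let $k$ satisfy the kernel regularity assumption with exponent $\mu$ given in the context. Fix $m\in\{2,3,4\}$. Suppose that there exist $0<\rho\le1$ and $L_\rho>0$ such that $a(t,\theta)=k(t,\gamma(\theta))\gamma'(\theta)$ satisfies $$\|a(\cdot,\theta)-a(\cdot,\eta)\|_{H_\mu(\Gamma)}\le L_\rho|\theta-\eta|^\rho,\qquad \theta,\eta\in[0,2\pi],$$ that the panel partitions satisfy $\max_{I\in\Pi_h}|I|\le C_\Pi h$, and that the Gauss order satisfies $q\ge\lceil m/2\rceil$. Then, for $f\in X_\alpha$ and $J_f=\sum_{j=1}^{n_d}[f]_{t_j^d}G_j$, $$\|(K-K_h^q)v_h\|_{H_\mu(\Gamma)}\le Ch^\rho\|v_h\|_\infty,\qquad v_h\in S_h,$$ $$\|(K-K_h^q)J_f\|_{H_\mu(\Gamma)}\le Ch^\rho\|J_f\|_\infty .$$ Consequently, $$\|P_h(K-K_h^q)v_h\|_{H_\beta(\Gamma)}\le Ch^\rho\|v_h\|_{H_\beta(\Gamma)},\qquad v_h\in S_h,$$ $$\|P_h(K-K_h^q)J_f\|_{H_\beta(\Gamma)}\le Ch^\rho\|J_f\|_\infty .$$ Here $C$ is independent of $h$, $v_h$ and $f$.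
   Context: **Contour.** $\Gamma\subset\mathbb C$ is a simple, closed, positively oriented contour of class $C^2$ with a regular $C^2$, $2\pi$-periodic parametrization $\gamma:\mathbb R\to\Gamma$ (so $\gamma(\theta+2\pi)=\gamma(\theta)$, $\gamma'(\theta)\ne0$, $\gamma$ injective on $[0,2\pi)$). $\mathcal D=\{t_1^d,\ldots,t_{n_d}^d\}\subset\Gamma$, $n_d\ge1$, is a set of distinct points, $t_j^d=\gamma(\theta_j^d)$ with $0<\theta_1^d<\cdots<\theta_{n_d}^d<2\pi$; the point $t_*=\gamma(0)=\gamma(2\pi)\notin\mathcal D$ is the cut. The continuity arcs are the $n_d$ open arcs of $\Gamma\setminus\mathcal D$. For a function $v$ with one-sided limits, $v(t_j^d\pm0)$ denote the limits along the orientation ($-$: incoming, $+$: outgoing), $[v]_{t_j^d}:=v(t_j^d+0)-v(t_j^d-0)$, and functions are represented by incoming values $v(t_j^d)=v(t_j^d-0)$. **Spaces.** For $0<\sigma<1$, $X_\sigma=PH_\sigma(\Gamma,\mathcal D)$ is the space of complex functions that are $\sigma$-Hölder on every continuity arc and have finite lateral limits at all points of $\mathcal D$, with norm $\|v\|_{X_\sigma}=\max_I(\|v\|_{\infty,I}+[v]_{\sigma,I})$, the maximum over the continuity arcs $I$; here $\overline I^{\,\ell}$ is $I$ completed by its two endpoints carrying the lateral values, $\|v\|_{\infty,I}=\sup_{\overline I^{\,\ell}}|v|$ and $[v]_{\sigma,I}=\sup_{t\ne s\in\overline I^{\,\ell}}|v(t)-v(s)|/|t-s|^\sigma$. If $n_d=1$,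 the distance $|t-s|$ in this seminorm is understood as the distance along the (single) completed arc. $\|\cdot\|_\infty$ is the supremum norm over $\Gamma$. $H_\sigma(\Gamma)$ ($0<\sigma\le1$) is the space of globally $\sigma$-Hölder (Lipschitz if $\sigma=1$) functions on $\Gamma$ with norm $\sup_\Gamma|v|+\sup_{t\ne s\in\Gamma}|v(t)-v(s)|/|t-s|^\sigma$. **Kernel regularity assumption.** There are constants $M_0,M_\mu$ with $|k(t,\tau)|\le M_0$ and $|k(t,\tau)-k(s,\tau)|\le M_\mu|t-s|^\mu$ for all $t,s,\tau\in\Gamma$, and a modulus of continuity $\omega_k$ with $\omega_k(r)\to0$ as $r\downarrow0$ such that $|k(t,\tau)-k(t,\zeta)|\le\omega_k(|\tau-\zeta|)$ for all $t,\tau,\zeta\in\Gamma$. **Operator.** $(Kv)(t)=\int_\Gamma k(t,\tau)v(\tau)\,d\tau=\int_0^{2\pi}a(t,\theta)v(\gamma(\theta))\,d\theta$. **Generators.** For $0\le\theta<2\pi$: $H_j(\gamma(\theta))=0$ if $0\le\theta\le\theta_j^d$ and $=1$ if $\theta_j^d<\theta<2\pi$; $R(\gamma(\theta))=\theta/(2\pi)$; $G_j:=H_j-R$. **Splines.** For an integer $n_B\ge4$ put $h=2\pi/n_B$ and choose a phase $\rho_h\in[0,h)$ with $\operatorname{dist}(\theta_j^d-\rho_h,h\mathbb Z)\ge\eta_0 h$ for $j=1,\ldots,n_d$, where $0<\eta_0<1/(2n_d)$ is fixed. Put $\theta_i^B=\rho_h+(i-1)h\ (\mathrm{mod}\ 2\pi)$,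 $t_i^B=\gamma(\theta_i^B)$, $i=1,\ldots,n_B$. Let $N_m$ be the centered cardinal B-spline of order $m$ (degree $m-1$, support $[-m/2,m/2]$, $\sum_{r\in\mathbb Z}N_m(x-r)=1$), $B_j(\gamma(\theta))=\sum_{\ell\in\mathbb Z}N_m\big((\theta-\theta_j^B)/h-\ell n_B\big)$, and $S_h=\operatorname{span}\{B_1,\ldots,B_{n_B}\}$. For a continuous function $v$ on $\Gamma$, $P_hv\in S_h$ is the unique spline with $(P_hv)(t_i^B)=v(t_i^B)$, $i=1,\ldots,n_B$. **Quadrature.** $\Pi_h$ is a partition of $[0,2\pi]$ into panels (intervals) $I$ of length $|I|$ that is the common refinement of the breakpoints of the periodic splines in $S_h$, the jump parameters $\theta_j^d$, the cut, and possibly finitely many additional points; thus on every panel $v_h\circ\gamma$ is a polynomial of degree at most $m-1$ for $v_h\in S_h$ and $J_f\circ\gamma$ is affine. $C_\Pi$ is independent of $h$. $Q_I^q$ is the $q$-point Gauss–Legendre rule on $I$, and $(K_h^qv)(t):=\sum_{I\in\Pi_h}Q_I^q[a(t,\cdot)\,v(\gamma(\cdot))]$. *)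

(* Defs.v *)
From HB Require Import structures.
From mathcomp Require Import all_boot all_order all_algebra.
From mathcomp Require Import complex polyrcf.
From mathcomp Require Import all_classical all_reals all_analysis.

Set Implicit Arguments.
Unset Strict Implicit.
Unset Printing Implicit Defensive.

Import Order.TTheory GRing.Theory Num.Theory.
Import numFieldNormedType.Exports.
Import ComplexField.Normc.

Local Open Scope classical_set_scope.
Local Open Scope ring_scope.
Local Open Scope complex_scope.

(* Conventions.  C is R[i], with modulus [normc : R[i] -> R].  Functions on
   the contour are functions R[i] -> R[i] of which only the values on the
   contour matter.  Limits, derivatives and integrals of complex-valued
   functions of a real variable are taken on real and imaginary parts. *)

Section Contour.
Variable R : realType.
Implicit Types (g : R -> R[i]) (t z : R[i]) (v : R[i] -> R[i]).

Definition cintegral (a b : R) (F : R -> R[i]) : R[i] :=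
  (\int[lebesgue_measure]_(x in `[a, b]) complex.Re (F x)) +i*
  (\int[lebesgue_measure]_(x in `[a, b]) complex.Im (F x)).

Definition cderiv g (x : R) : R[i] :=
  (derive1 (fun s => complex.Re (g s)) x) +i* (derive1 (fun s => complex.Im (g s)) x).

Definition is_C2 (f : R -> R) : Prop :=
  [/\ forall x, derivable f x 1,
      forall x, derivable (derive1 f) x 1
    & continuous (derive1 (derive1 f))].

Definition curve g : set R[i] := range g.

(* The bounded components of the complement of the curve, computed in R^2. *)
Definition curve_interior g : set R[i] := [set z | ~ curve g z /\
  bounded_set (connected_component
    [set p : R * R | ~ curve g (p.1 +i* p.2)]
    (complex.Re z, complex.Im z))].

(* Winding number 1 around the interior points. *)
Definition positively_oriented g : Prop := forall z, curve_interior g z ->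
  cintegral 0 (2 * pi) (fun x => cderiv g x / (g x - z)) = (2 * pi)%:C * 'i.

Definition C2_contour g : Prop :=
  [/\ is_C2 (fun s => complex.Re (g s)) /\ is_C2 (fun s => complex.Im (g s)),
      forall x, g (x + 2 * pi) = g x,
      forall x, cderiv g x != 0,
      forall x y, 0 <= x < 2 * pi -> 0 <= y < 2 * pi -> g x = g y -> x = y
    & positively_oriented g].

(* The parameter in [0, 2 pi) of a point of the curve. *)
Definition param g t : R := xget 0 [set x | 0 <= x < 2 * pi /\ g x = t].

Definition sup_norm g v : \bar R :=
  ereal_sup [set (normc (v t))%:E | t in curve g].

(* +oo when v is not s-Hoelder on the curve. *)
Definition holder_norm g (s : R) v : \bar R :=
  (sup_norm g v +
   ereal_sup [set y | exists t u, [/\ curve g t, curve g u, t != u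
     & y = (normc (v t - v u) / normc (t - u) `^ s)%:E]])%E.

End Contour.

Section Jumps.
Variables (R : realType) (g : R -> R[i]) (nd : nat) (thd : 'I_nd -> R).
Implicit Types (f : R[i] -> R[i]).

Definition jump_params : Prop :=
  [/\ (0 < nd)%N, forall j, 0 < thd j < 2 * pi
    & forall i j : 'I_nd, (i < j)%N -> thd i < thd j].

(* The open interval (a, b) parametrizes a continuity arc: a and b are
   consecutive elements of the 2 pi-periodic set generated by the jump
   parameters. *)
Definition lifted_jumps : set R :=
  [set x | exists j (z : int), x = thd j + 2 * pi * z%:~R].

Definition continuity_arc (a b : R) : Prop :=
  [/\ a < b, lifted_jumps a, lifted_jumps b
    & forall x, a < x < b -> ~ lifted_jumps x].

(* Distance in the Hoelder seminorm on an arc: |t - s| in general, arc length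
   when there is only one arc, since its two ends are then the same point. *)
Definition arc_dist (x y : R) : R :=
  if nd == 1%N then
    \int[lebesgue_measure]_(s in `[Num.min x y, Num.max x y])
      normc (cderiv g s)
  else normc (g x - g y).

Definition lim_out f (x : R) : R[i] :=
  lim (complex.Re (f (g s)) @[s --> x^'+]) +i*
  lim (complex.Im (f (g s)) @[s --> x^'+]).

Definition lim_in f (x : R) : R[i] :=
  lim (complex.Re (f (g s)) @[s --> x^'-]) +i*
  lim (complex.Im (f (g s)) @[s --> x^'-]).

Definition lateral_limits f (x : R) : Prop :=
  [/\ cvg (complex.Re (f (g s)) @[s --> x^'+]),
      cvg (complex.Im (f (g s)) @[s --> x^'+]),
      cvg (complex.Re (f (g s)) @[s --> x^'-])
    & cvg (complex.Im (f (g s)) @[s --> x^'-])].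

Definition PH (s : R) f : Prop :=
  [/\ forall a b, continuity_arc a b -> exists L : R,
        forall x y, a < x < b -> a < y < b ->
          normc (f (g x) - f (g y)) <= L * arc_dist x y `^ s,
      forall j, lateral_limits f (thd j)
    & forall j, f (g (thd j)) = lim_in f (thd j)].

Definition jump f (j : 'I_nd) : R[i] :=
  lim_out f (thd j) - lim_in f (thd j).

Definition gen_H (j : 'I_nd) (t : R[i]) : R := (thd j < param g t)%R%:R.
Definition gen_R (t : R[i]) : R := param g t / (2 * pi).
Definition gen_G (j : 'I_nd) (t : R[i]) : R := gen_H j t - gen_R t.

Definition jump_part f (t : R[i]) : R[i] :=
  \sum_(j < nd) jump f j * (gen_G j t)%:C.

End Jumps.

Section Kernel.
Variables (R : realType) (g : R -> R[i]) (k : R[i] -> R[i] -> R[i]).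

Definition kernel_regular (mu : R) : Prop :=
  exists (M0 Mmu : R) (omega : R -> R),
  [/\ forall t tau, curve g t -> curve g tau -> normc (k t tau) <= M0,
      forall t s tau, curve g t -> curve g s -> curve g tau ->
        normc (k t tau - k s tau) <= Mmu * normc (t - s) `^ mu,
      omega r @[r --> 0^'+] --> (0 : R)
    & forall t tau zeta, curve g t -> curve g tau -> curve g zeta ->
        normc (k t tau - k t zeta) <= omega (normc (tau - zeta))].

Definition akernel (t : R[i]) (x : R) : R[i] := k t (g x) * cderiv g x.

Definition Kop (v : R[i] -> R[i]) (t : R[i]) : R[i] :=
  cintegral 0 (2 * pi) (fun x => akernel t x * v (g x)).

End Kernel.

Section Splines.
Variable R : realType.

(* Centered cardinal B-spline of order m, by the Cox-de Boor recursion;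
   the order is m.+1 in [cbspline_rec m]. *)
Fixpoint cbspline_rec (m : nat) (x : R) : R :=
  if m is m'.+1 then
    ((m.+1%:R / 2 + x) * cbspline_rec m' (x + 2^-1) +
     (m.+1%:R / 2 - x) * cbspline_rec m' (x - 2^-1)) / m%:R
  else (- 2^-1 <= x < 2^-1)%R%:R.

Definition cbspline (m : nat) : R -> R := cbspline_rec m.-1.

Variables (g : R -> R[i]) (m n : nat) (phase : R).

Definition mesh : R := 2 * pi / n%:R.

(* Indices start at 0; for a phase in [0, mesh) these lie in [0, 2 pi). *)
Definition node (i : 'I_n) : R := phase + i%:R * mesh.

Definition bspline (j : 'I_n) (t : R[i]) : R :=
  \sum_(l \in [set: int])
    cbspline m ((param g t - node j) / mesh - l%:~R * n%:R).

Definition spline_space : set (R[i] -> R[i]) :=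
  [set v | exists c : 'I_n -> R[i], forall t, curve g t ->
    v t = \sum_(j < n) c j * (bspline j t)%:C].

Definition spline_interp (v : R[i] -> R[i]) : R[i] -> R[i] :=
  xget (fun=> 0) [set w : R[i] -> R[i] | spline_space w /\
    forall i : 'I_n, w (g (node i)) = v (g (node i))].

(* Breakpoints on the real line of the periodic splines in the parameter. *)
Definition breakpoint (z : int) : R := phase + (z%:~R + m%:R / 2) * mesh.

End Splines.

Section Quadrature.
Variable R : realType.

(* Rodrigues' formula. *)
Definition legendre (q : nat) : {poly R} :=
  (2 ^+ q * q`!%:R)^-1 *: (('X^2 - 1) ^+ q)^`(q)%R.

Definition gauss_nodes (q : nat) : seq R := roots (legendre q) (-1) 1.

Definition gauss_weight (q : nat) (x : R) : R :=
  \int[lebesgue_measure]_(s in `[-1, 1])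
    (\prod_(y <- gauss_nodes q | y != x) ((x - y)^-1 *: ('X - y%:P))).[s].

Definition gauss_rule (q : nat) (a b : R) (F : R -> R[i]) : R[i] :=
  ((b - a) / 2)%:C * \sum_(x <- gauss_nodes q)
    (gauss_weight q x)%:C * F ((a + b) / 2 + (b - a) / 2 * x).

(* A partition of [0, 2 pi] is given by its increasing list p of endpoints;
   its panels are [p`_i, p`_i.+1] for i < (size p).-1. *)
Definition panel_partition (nd : nat) (thd : 'I_nd -> R)
    (m n : nat) (phase : R) (p : seq R) : Prop :=
  [/\ sorted <%R p, head 0 p = 0, last 0 p = 2 * pi,
      forall j, thd j \in p
    & forall z, 0 <= breakpoint m n phase z <= 2 * pi ->
        breakpoint m n phase z \in p].

Definition Kquad (g : R -> R[i]) (k : R[i] -> R[i] -> R[i]) (q : nat)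
    (p : seq R) (v : R[i] -> R[i]) (t : R[i]) : R[i] :=
  \sum_(i < (size p).-1)
    gauss_rule q p`_i p`_i.+1 (fun x => akernel g k t x * v (g x)).

End Quadrature.

(* Main.v *)
(** On each panel [v (gamma)] is a polynomial of degree less than [2q], on which
    the Gauss rule is exact. The kernel may therefore be replaced there by its
    oscillation, which is [O(h^rho)] because the panels have length [O(h)]; summing
    over the panels bounds [(K - K_h^q) v] at a point [t]. Applied to the difference
    of the kernels at [t] and [s], the same argument gives the factor [|t - s|^mu].

    For [m <= 4] the collocation matrix of spline interpolation is tridiagonal,
    circulant and strictly diagonally dominant, so its inverse is bounded in the
    maximum norm. As it commutes with translations, the differences of the spline
    coefficients inherit the Hoelder modulus of the data, and the partition of unity
    passes it on to the spline as a function of the parameter. Parameter distances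
    and chords are comparable on a regular simple closed curve; hence [P_h] is
    bounded from [H_mu] to [H_beta], uniformly in [h]. *)
Require Import Defs.
From HB Require Import structures.
From mathcomp Require Import all_boot all_order all_algebra.
From mathcomp Require Import complex polyrcf.
From mathcomp Require Import all_classical all_reals all_analysis.
From mathcomp Require Import measurable_realfun.
From mathcomp Require Import ring lra zify.

Set Implicit Arguments.
Unset Strict Implicit.
Unset Printing Implicit Defensive.

Import Order.TTheory GRing.Theory Num.Theory.
Import numFieldNormedType.Exports.
Import ComplexField.Normc.
Local Open Scope classical_set_scope.
Local Open Scope ring_scope.

(** * Gauss-Legendre quadrature *)

(** The rule is given only through the roots of the Legendre polynomial in []-1, 1[] and integrals
    of Lagrange polynomials; that it has [q] nodes and is exact has to be proved. Exactness serves
    to subtract from the kernel its value at the midpoint of a panel, and the oscillation that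
    remains is all that is estimated. Splines and jump parts thus fall under one estimate, for
    functions that are polynomial inside each panel.

    A spline is treated as a function on the real line with periodic coefficients indexed by the
    integers, evaluated through a window of six terms. Collocation becomes a three-term recurrence,
    bounded at an index of maximal modulus, and a translation by a mesh width becomes a shift of the
    index. Uniformity in [h] comes from a cancellation: differences of coefficients carry a factor
    [h^beta], which the rescaling of the parameter by [1/h] removes. Going from exponent [mu] to
    [beta] costs a power of the diameter of the contour. *)

Section GaussExactness.
Variable R : realType.
Implicit Types (p u s w : {poly R}) (a b x : R) (q k : nat).

Definition primitive p : {poly R} :=
  \poly_(i < (size p).+1) (p`_i.-1 / i%:R).

Lemma deriv_primitive p : (primitive p)^`() = p.
Proof.
apply/polyP => i; rewrite coef_deriv coef_poly ltnS.
case: ltnP => hi; last by rewrite mul0rn nth_default.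
by rewrite -[LHS]mulr_natr divfK ?pnatr_eq0.
Qed.

Lemma Rintegral_poly a b p : a < b ->
  \int[lebesgue_measure]_(x in `[a, b]) p.[x] =
  (primitive p).[b] - (primitive p).[a].
Proof.
move=> ab; rewrite /Rintegral.
rewrite (@continuous_FTC2 _ (horner p) (horner (primitive p)) a b ab) //.
- by apply: continuous_subspaceT => x; exact: continuous_horner.
- split.
  + by move=> x _; exact: derivable_horner.
  + by apply: cvg_at_right_filter; exact: continuous_horner.
  + by apply: cvg_at_left_filter; exact: continuous_horner.
- by move=> x _; rewrite -derivE deriv_primitive.
Qed.

Lemma Rintegral_deriv a b p : a < b ->
  \int[lebesgue_measure]_(x in `[a, b]) (p^`()).[x] = p.[b] - p.[a].
Proof.
move=> ab; rewrite Rintegral_poly //.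
(* Two polynomials with the same derivative differ by a constant, the characteristic being zero. *)
suff [c ->] : exists c, primitive p^`() = p + c%:P by rewrite !hornerE; ring.
have /eqP : (primitive p^`() - p)^`() = 0 by rewrite derivB deriv_primitive subrr.
rewrite -size_poly_eq0 polyorder.size_deriv => d0.
have : (size (primitive p^`() - p)%R <= 1)%N by move: d0; case: (size _) => [|[]].
by move=> /size1_polyC e; exists (primitive p^`() - p)`_0; rewrite -e addrC subrK.
Qed.

Lemma integrable_poly a b p :
  lebesgue_measure.-integrable `[a, b] (EFin \o horner p).
Proof.
apply: continuous_compact_integrable; first exact: segment_compact.
by apply: continuous_subspaceT => x; exact: continuous_horner.
Qed.

Lemma Rintegral_polyD a b p s :
  \int[lebesgue_measure]_(x in `[a, b]) (p + s).[x] =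
  \int[lebesgue_measure]_(x in `[a, b]) p.[x] +
  \int[lebesgue_measure]_(x in `[a, b]) s.[x].
Proof.
rewrite -RintegralD //; try exact: integrable_poly.
by apply: eq_Rintegral => x _; rewrite hornerD.
Qed.

Lemma Rintegral_polyZ a b (c : R) p :
  \int[lebesgue_measure]_(x in `[a, b]) (c *: p).[x] =
  c * \int[lebesgue_measure]_(x in `[a, b]) p.[x].
Proof.
rewrite -RintegralZl //; try exact: integrable_poly.
by apply: eq_Rintegral => x _; rewrite hornerZ.
Qed.

Lemma Rintegral_poly_sum a b I (r : seq I) (F : I -> {poly R}) :
  \int[lebesgue_measure]_(x in `[a, b]) (\sum_(i <- r) F i).[x] =
  \sum_(i <- r) \int[lebesgue_measure]_(x in `[a, b]) (F i).[x].
Proof.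
elim: r => [|i r IH]; last by rewrite !big_cons Rintegral_polyD IH.
rewrite !big_nil (_ : 0 = (0 : R) *: (0 : {poly R})) ?scale0r //.
by rewrite -[in LHS](scale0r (0 : {poly R})) Rintegral_polyZ mul0r.
Qed.

(* Repeated integration by parts; all boundary terms vanish. *)
Lemma derivn_orthogonal a b u k s : a < b ->
  (forall j, (j < k)%N -> root u^`(j) a /\ root u^`(j) b) ->
  (size s <= k)%N ->
  \int[lebesgue_measure]_(x in `[a, b]) (u^`(k) * s).[x] = 0.
Proof.
move=> ab; elim: k s => [|k IH] s hu hs.
  move: hs; rewrite leqn0 size_poly_eq0 => /eqP ->.
  by rewrite mulr0 -(scale0r (0 : {poly R})) Rintegral_polyZ mul0r.
have -> : u^`(k.+1) * s = (u^`(k) * s)^`() + (-1) *: (u^`(k) * s^`()).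
  by rewrite derivM derivnS scaleN1r addrK.
rewrite Rintegral_polyD Rintegral_polyZ Rintegral_deriv // IH.
- have [ra rb] := hu k (ltnSn k).
  by rewrite !hornerM (rootP ra) (rootP rb) !mul0r subrr mulr0 addr0.
- by move=> j jk; apply: hu; rewrite ltnS ltnW.
- have [->|s0] := eqVneq s 0; first by rewrite linear0 size_poly0.
  by rewrite -ltnS (leq_trans (lt_size_deriv s0)).
Qed.

(** Each differentiation lowers the power of [p] dividing the polynomial by at most one. *)
Lemma root_derivn_exp p q j x : root p x -> (j < q)%N -> root (p ^+ q)^`(j) x.
Proof.
move=> px jq.
have [s ->] : exists s, (p ^+ q)^`(j) = p ^+ (q - j) * s; last first.
  by rewrite -(subnSK jq) exprS !rootM px.
elim: j jq => [|j IH] jq; first by exists 1; rewrite subn0 mulr1.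
have [s es] := IH (ltnW jq); rewrite derivnS es -(subnSK (ltnW jq)) derivM deriv_exp.
exists (p^`() * s *+ (q - j.+1).+1 + p * s^`()).
by rewrite /= mulrDr exprS mulrnAl mulrnAr; congr (_ *+ _ + _); ring.
Qed.

(* Rolle's theorem at each step, the end points being roots of all the lower
   derivatives. *)
Lemma derivn_roots a b u k : a < b ->
  (forall j, (j < k)%N -> root u^`(j) a /\ root u^`(j) b) ->
  exists r : seq R, [/\ size r = k, path <%R a r, all (fun x => x < b) r
    & all (root u^`(k)) r].
Proof.
move=> ab; elim: k => [|k IH] hu; first by exists [::].
have [|r [sr pr br rr]] := IH; first by move=> j jk; apply: hu; rewrite ltnS ltnW.
have [ra rb] := hu k (ltnSn k).
set p := u^`(k) in ra rb rr *.
have -> : u^`(k.+1) = p^`() by rewrite derivnS.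
rewrite -sr; clear -ab pr br rr ra rb.
elim: r a ab pr br rr ra => [|y r IHr] a ab pr br rr ra.
  have [|c /[!in_itv]/= /andP[ac cb] c0] := @poly_rolle _ a b p ab.
    by rewrite (rootP ra) (rootP rb).
  by exists [:: c]; split; rewrite //= ?ac ?cb ?andbT //; apply/rootP.
move: pr br rr => /= /andP[ay yr] /andP[yb rb'] /andP[py pr].
have [r' [sr' pr' br' rr']] := IHr y yb yr rb' pr py.
have [|c /[!in_itv]/= /andP[ac cy] c0] := @poly_rolle _ a y p ay.
  by rewrite (rootP ra) (rootP py).
exists (c :: r'); split; rewrite /= ?sr' ?ac ?(lt_trans cy yb) //.
- by rewrite (path_le lt_trans cy).
- by rewrite rr' andbT; apply/rootP.
Qed.

Lemma size_derivn p k : size p^`(k) = (size p - k)%N.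
Proof.
by elim: k => [|k IH]; rewrite ?subn0 // derivnS polyorder.size_deriv IH subnS.
Qed.

Lemma size_legendre q : size (legendre R q) = q.+1.
Proof.
rewrite size_scale; last first.
  by rewrite invr_eq0 mulf_neq0 ?expf_neq0 ?pnatr_eq0 // -lt0n fact_gt0.
have s2 : size ('X^2 - 1 : {poly R}) = 3%N by rewrite size_XnsubC.
have := size_exp ('X^2 - 1 : {poly R}) q; rewrite s2 /= => h.
have : size (('X^2 - 1 : {poly R}) ^+ q) != 0%N.
  by rewrite size_poly_eq0 expf_neq0 // -size_poly_eq0 s2.
rewrite size_derivn; move: h; case: (size _) => //= n -> _; lia.
Qed.

Lemma root_sqrX_sub1 : root ('X^2 - 1 : {poly R}) (-1) /\ root ('X^2 - 1 : {poly R}) 1.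
Proof. by split; apply/rootP; rewrite !hornerE; ring. Qed.

Let N1lt1 : (-1 : R) < 1. Proof. lra. Qed.

Let rodrigues_roots q j : (j < q)%N ->
  root (('X^2 - 1 : {poly R}) ^+ q)^`(j) (-1) /\
  root (('X^2 - 1 : {poly R}) ^+ q)^`(j) 1.
Proof. by have [? ?] := root_sqrX_sub1 => jq; split; exact: root_derivn_exp. Qed.

(** The degree gives at most [q] nodes. For the converse, [1] and [-1] are roots of [(X^2 - 1)^q]
    and of its derivatives of order below [q], so [derivn_roots] finds [q] interior roots of the
    [q]-th derivative. *)
Lemma size_gauss_nodes q : size (gauss_nodes R q) = q.
Proof.
have L0 : legendre R q != 0 by rewrite -size_poly_eq0 size_legendre.
apply/eqP; rewrite eqn_leq; apply/andP; split.
  rewrite -ltnS -(size_legendre q); apply: max_poly_roots => //.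
    by apply/allP => x /root_roots.
  exact: uniq_roots.
have [r [sr pr br rr]] := derivn_roots N1lt1 (@rodrigues_roots q).
rewrite -[in leqLHS]sr; apply: uniq_leq_size.
  apply: (sorted_uniq lt_trans ltxx); exact: path_sorted pr.
move=> x xr; rewrite /gauss_nodes in_roots L0 andbT; apply/andP; split.
  rewrite rootZ; first exact: (allP rr).
  by rewrite invr_eq0 mulf_neq0 ?expf_neq0 ?pnatr_eq0 // -lt0n fact_gt0.
rewrite in_itv /= (allP br x xr) andbT.
by have /allP := order_path_min lt_trans pr; apply.
Qed.

Lemma legendre_orthogonal q s : (size s <= q)%N ->
  \int[lebesgue_measure]_(x in `[-1, 1]) (legendre R q * s).[x] = 0.
Proof.
move=> hs; rewrite /legendre -scalerAl Rintegral_polyZ.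
by rewrite (derivn_orthogonal N1lt1 (@rodrigues_roots q)) // mulr0.
Qed.

Lemma gauss_nodes_itv q x : x \in gauss_nodes R q -> -1 < x < 1.
Proof. by move=> /roots_in; rewrite in_itv. Qed.

Definition lagrange_basis (r : seq R) x : {poly R} :=
  \prod_(y <- r | y != x) ((x - y)^-1 *: ('X - y%:P)).

Lemma lagrange_interpolation (r : seq R) s : uniq r -> (size s <= size r)%N ->
  s = \sum_(x <- r) s.[x] *: lagrange_basis r x.
Proof.
move=> ur sr; apply/eqP; rewrite -subr_eq0; apply/eqP.
apply: (@poly_ltsp_roots _ _ r) => //.
- apply: (leq_trans (size_polyD _ _)); rewrite geq_max sr size_polyN.
  apply: (leq_trans (size_sum _ _ _)); apply/bigmax_leqP_seq => x xr _.
  apply: (leq_trans (size_scale_leq _ _)).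
  rewrite /lagrange_basis scaler_prod.
  apply: (leq_trans (size_scale_leq _ _)).
  rewrite -big_filter size_prod_XsubC -(rem_filter x ur) size_rem //.
  by case: (r) xr.
- apply/allP => z zr; apply/rootP; rewrite hornerD hornerN horner_sum.
  rewrite (bigD1_seq z) //= big1_seq ?addr0; last first.
    move=> x /andP[xz xr]; rewrite hornerZ horner_prod -big_filter (bigD1_seq z) /=.
    - by rewrite !hornerE subrr /= !(mulr0, mul0r).
    - by rewrite mem_filter eq_sym xz.
    - exact: filter_uniq.
  rewrite hornerZ horner_prod big1_seq ?mulr1 ?subrr // => y /andP[yz yr].
  by rewrite !hornerE mulVf // subr_eq0 eq_sym.
Qed.

(** Division by the Legendre polynomial: the multiple of it has integral zero by orthogonality and
    vanishes at the nodes, while the remainder equals its Lagrange interpolant, whose integral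
    defines the weights. *)
Lemma gauss_exact q w : (size w <= q.*2)%N ->
  \int[lebesgue_measure]_(x in `[-1, 1]) w.[x] =
  \sum_(x <- gauss_nodes R q) gauss_weight q x * w.[x].
Proof.
move=> sw; set L := legendre R q.
have L0 : L != 0 by rewrite -size_poly_eq0 size_legendre.
pose s := w %/ L; pose r := w %% L.
have e : w = L * s + r by rewrite mulrC; exact: divp_eq.
have ss : (size s <= q)%N by rewrite size_divp // size_legendre /= leq_subLR addnn.
have sr : (size r <= q)%N by rewrite -ltnS -(size_legendre q) ltn_modp.
rewrite {1}e Rintegral_polyD legendre_orthogonal // add0r.
have un : uniq (gauss_nodes R q) := uniq_roots _ _ _.
rewrite {1}(@lagrange_interpolation _ r un) ?size_gauss_nodes //.
rewrite Rintegral_poly_sum; apply: eq_big_seq => x xr.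
rewrite Rintegral_polyZ mulrC; congr (_ * _).
by rewrite e hornerD hornerM (rootP (root_roots xr)) mul0r add0r.
Qed.

Definition real_gauss q a b (f : R -> R) : R :=
  (b - a) / 2 * \sum_(x <- gauss_nodes R q)
    gauss_weight q x * f ((a + b) / 2 + (b - a) / 2 * x).

Lemma real_gauss_exact q a b w : a < b -> (size w <= q.*2)%N ->
  \int[lebesgue_measure]_(x in `[a, b]) w.[x] = real_gauss q a b (horner w).
Proof.
move=> ab sw; pose l : {poly R} := ((b - a) / 2) *: 'X + ((a + b) / 2)%:P.
have lE x : l.[x] = (a + b) / 2 + (b - a) / 2 * x by rewrite !hornerE; ring.
have dl : l^`() = ((b - a) / 2)%:P.
  by rewrite derivD derivC derivZ derivX addr0 alg_polyC.
rewrite -{1}(deriv_primitive w) Rintegral_deriv // /real_gauss.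
under eq_bigr do rewrite -lE -horner_comp.
rewrite -gauss_exact; last first.
  apply: leq_trans sw; have [->|w0] := eqVneq w 0.
    by rewrite comp_poly0 size_poly0.
  apply: leq_trans (size_comp_poly_leq _ _) _.
  have : (size l <= 2)%N.
    rewrite (leq_trans (size_polyD _ _)) // geq_max (leq_trans (size_polyC_leq1 _)) //.
    by rewrite andbT (leq_trans (size_scale_leq _ _)) ?size_polyX.
  move: w0; rewrite -size_poly_eq0; case: (size w) => // n _.
  by case: (size l) => [|[|[]]] //=; rewrite ?muln0 ?muln1.
rewrite -Rintegral_polyZ.
(* The affine change of variables is made on primitives: both integrals become the same difference
   of values of [primitive w]. *)
have -> : ((b - a) / 2) *: (w \Po l) = (primitive w \Po l)^`().
  by rewrite deriv_comp deriv_primitive dl [RHS]mulrC mul_polyC.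
by rewrite Rintegral_deriv // !horner_comp !lE; congr (_.[_] - _.[_]); field.
Qed.

End GaussExactness.

(** * Integrals and quadrature error on one panel *)

Section PanelQuadrature.
Variable R : realType.
Implicit Types (a b x y A B M : R) (f h F w : R -> R) (q : nat).
Local Notation mu := (@lebesgue_measure R).

(** The integrands are known to be polynomial times kernel only inside a panel, since jumps may sit
    at its ends. This lemma and the next two discard the end points as a null set. *)
Lemma measurable_fun_oo_cc a b f h :
  {in `]a, b[, f =1 h} -> measurable_fun `[a, b] h -> measurable_fun `[a, b] f.
Proof.
move=> fh mh; apply: (@measurable_fun_itv_cc _ a b false true).
apply: (@eq_measurable_fun _ _ _ _ _ h) => [x|].
  by rewrite inE => xab; rewrite fh.
by apply: measurable_funS mh => //; exact: subset_itv_oo_cc.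
Qed.

Lemma integrable_oo_cc a b f h : {in `]a, b[, f =1 h} ->
  mu.-integrable `[a, b] (EFin \o h) -> mu.-integrable `[a, b] (EFin \o f).
Proof.
move=> fh /integrableP[mh ih].
have mh' : measurable_fun `[a, b] h by apply/measurable_EFinP.
have mf : measurable_fun `[a, b] f := measurable_fun_oo_cc fh mh'.
apply/integrableP; split; first exact/measurable_EFinP.
rewrite (_ : \int[_]_(_ in _) _ = \int[mu]_(x in `[a, b]) `|(EFin \o h) x|)%E //.
have moo (u : R -> R) : measurable_fun `[a, b] u -> measurable_fun `]a, b[ (Num.norm \o u).
  move=> mu'; apply: measurableT_comp => //.
  by apply: measurable_funS mu' => //; exact: subset_itv_oo_cc.
apply: (@eq_integral_itv_bounded _ a b (Num.norm \o h) (Num.norm \o f)).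
- exact: moo.
- exact: moo.
- by move=> x xab; rewrite /= fh.
Qed.

Lemma Rintegral_oo_cc a b f h : {in `]a, b[, f =1 h} ->
  mu.-integrable `[a, b] (EFin \o h) ->
  \int[mu]_(x in `[a, b]) f x = \int[mu]_(x in `[a, b]) h x.
Proof.
move=> fh /[dup] ih /(integrable_oo_cc fh) if_; rewrite /Rintegral.
congr fine; apply: eq_integral_itv_bounded => //.
- apply: measurable_funS (_ : measurable_fun `[a, b] f) => //.
    exact: subset_itv_oo_cc.
  by apply/measurable_EFinP; exact: measurable_int if_.
- apply: measurable_funS (_ : measurable_fun `[a, b] h) => //.
    exact: subset_itv_oo_cc.
  by apply/measurable_EFinP; exact: measurable_int ih.
Qed.

Lemma le_normr_Rintegral_itv a b f A : a <= b ->
  mu.-integrable `[a, b] (EFin \o f) ->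
  (forall x, a < x < b -> `|f x| <= A) ->
  `|\int[mu]_(x in `[a, b]) f x| <= A * (b - a).
Proof.
move=> ab if_ hf.
(* The bound on [f] is assumed in the open interval only; [h] satisfies it on the closed one. *)
pose h x := if x \in `]a, b[ then f x else 0.
have fh : {in `]a, b[, h =1 f} by move=> x xab; rewrite /h xab.
have ih := integrable_oo_cc fh if_.
rewrite -(Rintegral_oo_cc fh if_).
have [->|ab'] := eqVneq a b; first by rewrite set_itv1 Rintegral_set1 normr0 subrr mulr0.
have ab2 : a < b by rewrite lt_neqAle ab' ab.
have A0 : 0 <= A by apply: le_trans (hf ((a + b) / 2) _); rewrite ?normr_ge0 //; lra.
apply: le_trans (le_normr_Rintegral _ ih) _ => //.
have -> : A * (b - a) = \int[mu]_(_ in `[a, b]) A.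
  rewrite Rintegral_cst //= lebesgue_measure_itv /= lte_fin ab2.
  by rewrite -EFinB.
apply: le_Rintegral => //.
- exact: integrable_norm.
- apply: continuous_compact_integrable; first exact: segment_compact.
  by apply: continuous_subspaceT => x; exact: cvg_cst.
- move=> x _ /=; rewrite /h; case: ifPn => [|_]; last by rewrite normr0.
  by rewrite in_itv /=; exact: hf.
Qed.

(** The summand 1 pays for the integral and the sum of absolute weights for the rule, so a panel
    error is bounded with one constant. *)
Definition gauss_const q : R :=
  1 + \sum_(x <- gauss_nodes R q) `|gauss_weight q x|.

Lemma gauss_const_ge1 q : 1 <= gauss_const q.
Proof. by rewrite lerDl sumr_ge0. Qed.

Lemma real_gaussD q a b f h :
  real_gauss q a b (fun x => f x + h x) = real_gauss q a b f + real_gauss q a b h.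
Proof.
rewrite /real_gauss -mulrDr -big_split /=; congr (_ * _).
by apply: eq_bigr => x _; rewrite mulrDr.
Qed.

Lemma real_gaussZ q a b (c : R) f :
  real_gauss q a b (fun x => c * f x) = c * real_gauss q a b f.
Proof.
rewrite /real_gauss [RHS]mulrCA; congr (_ * _); rewrite mulr_sumr.
by apply: eq_bigr => x _; rewrite mulrCA.
Qed.

Lemma gauss_node_affine q a b x : a < b -> x \in gauss_nodes R q ->
  a < (a + b) / 2 + (b - a) / 2 * x < b.
Proof. by move=> ab /gauss_nodes_itv xq; nra. Qed.

Lemma eq_real_gauss q a b f h : a < b -> {in `]a, b[, f =1 h} ->
  real_gauss q a b f = real_gauss q a b h.
Proof.
move=> ab fh; rewrite /real_gauss; congr (_ * _).
apply: eq_big_seq => x xq; rewrite fh // in_itv /=.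
exact: gauss_node_affine xq.
Qed.

Lemma le_real_gauss q a b f A : a < b ->
  (forall x, a < x < b -> `|f x| <= A) ->
  `|real_gauss q a b f| <= (gauss_const q - 1) * A * (b - a).
Proof.
move=> ab hf.
have ba : 0 <= (b - a) / 2 by lra.
rewrite /gauss_const (addrC 1) addrK /real_gauss normrM (ger0_norm ba).
set Z := (X in `|X|); set T := (X in X * A * _).
have hZ : `|Z| <= T * A.
  rewrite /T mulr_suml; apply: le_trans (ler_norm_sum _ _ _) _.
  rewrite big_seq [leRHS]big_seq; apply: ler_sum => x xq.
  by rewrite normrM ler_wpM2l // hf // (gauss_node_affine ab xq).
by have := normr_ge0 Z; nra.
Qed.

(* Subtracting the constant [F (midpoint)] from [F] costs nothing, the rule
   being exact on [w]. *)
Lemma panel_error q a b F w (W : {poly R}) A M : a < b ->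
  {within `[a, b], continuous F} ->
  (forall x y, x \in `[a, b] -> y \in `[a, b] -> `|F x - F y| <= A) ->
  (size W <= q.*2)%N -> {in `]a, b[, w =1 horner W} ->
  (forall x, a < x < b -> `|w x| <= M) ->
  mu.-integrable `[a, b] (EFin \o (fun x => F x * w x)) /\
  `|\int[mu]_(x in `[a, b]) (F x * w x) - real_gauss q a b (fun x => F x * w x)|
    <= gauss_const q * (A * M) * (b - a).
Proof.
move=> ab cF hF sW wW hw.
have cW : {within `[a, b], continuous (horner W)}.
  by apply: continuous_subspaceT => x; exact: continuous_horner.
have iprod f : {within `[a, b], continuous f} ->
    mu.-integrable `[a, b] (EFin \o (fun x => f x * W.[x])).
  move=> cf; apply: continuous_compact_integrable; first exact: segment_compact.
  by move=> x; apply: (@continuousM _ (subspace _)); [exact: cf|exact: cW].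
have FW : {in `]a, b[, (fun x => F x * w x) =1 (fun x => F x * W.[x])}.
  by move=> x xab; rewrite /= wW.
have iFW := iprod _ cF.
split; first exact: integrable_oo_cc FW iFW.
rewrite (Rintegral_oo_cc FW iFW) (eq_real_gauss q ab FW).
pose c := F ((a + b) / 2).
have mid : (a + b) / 2 \in `[a, b].
  by rewrite in_itv /=; apply/andP; split; [have := midf_le (ltW ab)|have := midf_le (ltW ab)]; lra.
have cFc : {within `[a, b], continuous (fun x => F x - c)}.
  by move=> x; apply: (@continuousB _ _ (subspace _)); [exact: cF|exact: cvg_cst].
have iFcW := iprod _ cFc.
have -> : \int[mu]_(x in `[a, b]) (F x * W.[x]) =
    \int[mu]_(x in `[a, b]) ((F x - c) * W.[x]) +
    c * \int[mu]_(x in `[a, b]) W.[x].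
  rewrite -RintegralZl //; last exact: integrable_poly.
  rewrite -RintegralD //; last first.
    by apply: (iprod (fun=> c)); apply: continuous_subspaceT => x; exact: cvg_cst.
  by apply: eq_Rintegral => x _; ring.
have -> : real_gauss q a b (fun x => F x * W.[x]) =
    real_gauss q a b (fun x => (F x - c) * W.[x]) +
    c * real_gauss q a b (horner W).
  rewrite -real_gaussZ -real_gaussD; congr real_gauss.
  by apply/funext => x; ring.
rewrite (real_gauss_exact ab sW) opprD addrACA subrr addr0.
have bnd x : a < x < b -> `|(F x - c) * W.[x]| <= A * M.
  move=> xab; rewrite normrM ler_pM // ?hF //.
  - by rewrite in_itv /=; case/andP: xab => /ltW -> /ltW ->.
  - by rewrite -wW ?hw // in_itv.
apply: le_trans (ler_normB _ _) _.
have := le_normr_Rintegral_itv (ltW ab) iFcW bnd.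
have := le_real_gauss q ab bnd.
lra.
Qed.

Lemma Rintegral_path_split f x (s : seq R) : path <%R x s ->
  (forall i, (i < size s)%N ->
    mu.-integrable `[(x :: s)`_i, s`_i] (EFin \o f)) ->
  mu.-integrable `[x, last x s] (EFin \o f) /\
  \int[mu]_(t in `[x, last x s]) f t =
    \sum_(i < size s) \int[mu]_(t in `[(x :: s)`_i, s`_i]) f t.
Proof.
elim: s x => [|y s IH] x /=.
  move=> _ _; split; last by rewrite big_ord0 set_itv1 Rintegral_set1.
  (* The open interval from [x] to [x] is empty, so [f] agrees with 0 on it. *)
  apply: (@integrable_oo_cc x x f (fun=> 0)); first by move=> z; rewrite in_itv /=; lra.
  exact: integrable0.
move=> /andP[xy py] hi.
have [i2 e2] := IH y py (fun i => hi i.+1).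
have i1 : mu.-integrable `[x, y] (EFin \o f) := hi 0%N isT.
have yl : y <= last y s.
  have /allP := order_path_min lt_trans py; case: s {IH py hi i2 e2} => //= z s.
  by move=> /(_ _ (mem_last z s))/ltW.
have i2' : mu.-integrable `]y, last y s] (EFin \o f).
  by apply: integrableS i2 => //; exact: subset_itv_oc_cc.
have eU : `[x, last y s]%classic = `[x, y] `|` `]y, last y s].
  by rewrite -itv_bndbnd_setU // bnd_simp // ltW.
have dU : [disjoint `[x, y] & `]y, last y s]].
  rewrite disj_set2E; apply/eqP; rewrite -subset0 => z [] /=.
  by rewrite !in_itv /=; lra.
have iU : mu.-integrable (`[x, y] `|` `]y, last y s]) (EFin \o f).
  move: i1 i2' => /integrableP[m1 l1] /integrableP[m2 l2].
  have mU : measurable_fun (`[x, y] `|` `]y, last y s]) (EFin \o f).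
    by apply/measurable_funU.
  apply/integrableP; split => //.
  by rewrite ge0_integral_setU //; [exact: lte_add_pinfty|exact: measurableT_comp].
split; first by rewrite eU.
rewrite eU Rintegral_setU // big_ord_recl /=; congr (_ + _).
by rewrite Rintegral_itv_obnd_cbnd // e2.
Qed.

End PanelQuadrature.

(** * Real and imaginary parts, and the modulus *)

Section ComplexParts.
Variable R : realType.
Implicit Types z w : R[i].

Lemma Re_add z w : complex.Re (z + w) = complex.Re z + complex.Re w.
Proof. by case: z w => [? ?] []. Qed.
Lemma Im_add z w : complex.Im (z + w) = complex.Im z + complex.Im w.
Proof. by case: z w => [? ?] []. Qed.
Lemma Re_sub z w : complex.Re (z - w) = complex.Re z - complex.Re w.
Proof. by case: z w => [? ?] []. Qed.
Lemma Im_sub z w : complex.Im (z - w) = complex.Im z - complex.Im w.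
Proof. by case: z w => [? ?] []. Qed.
Lemma Re_mul z w : complex.Re (z * w) =
  complex.Re z * complex.Re w - complex.Im z * complex.Im w.
Proof. by case: z w => [? ?] []. Qed.
Lemma Im_mul z w : complex.Im (z * w) =
  complex.Re z * complex.Im w + complex.Im z * complex.Re w.
Proof. by case: z w => [? ?] []. Qed.

Lemma Re_sum I (r : seq I) (P : pred I) (F : I -> R[i]) :
  complex.Re (\sum_(i <- r | P i) F i) = \sum_(i <- r | P i) complex.Re (F i).
Proof. by rewrite (big_morph _ Re_add (erefl (complex.Re (0 : R[i])))). Qed.
Lemma Im_sum I (r : seq I) (P : pred I) (F : I -> R[i]) :
  complex.Im (\sum_(i <- r | P i) F i) = \sum_(i <- r | P i) complex.Im (F i).
Proof. by rewrite (big_morph _ Im_add (erefl (complex.Im (0 : R[i])))). Qed.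

Lemma normc_ge0 z : 0 <= normc z.
Proof. by case: z => a b; exact: sqrtr_ge0. Qed.

Lemma normc_le_parts z : normc z <= `|complex.Re z| + `|complex.Im z|.
Proof.
case: z => a b /=; rewrite -[leRHS]ger0_norm ?addr_ge0 // -sqrtr_sqr.
rewrite ler_sqrt ?sqr_ge0 // sqrrD !real_normK ?num_real //.
by rewrite addrAC lerDl mulrn_wge0 // mulr_ge0.
Qed.

Lemma normRe_le z : `|complex.Re z| <= normc z.
Proof. by case: z => a b /=; rewrite -sqrtr_sqr ler_wsqrtr // lerDl sqr_ge0. Qed.

Lemma normIm_le z : `|complex.Im z| <= normc z.
Proof. by case: z => a b /=; rewrite -sqrtr_sqr ler_wsqrtr // lerDr sqr_ge0. Qed.

Lemma normc_real (x : R) : normc (x%:C)%C = `|x|.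
Proof. by rewrite /= expr0n /= addr0 sqrtr_sqr. Qed.

Lemma le_normcB z w : normc (z - w) <= normc z + normc w.
Proof. by rewrite -(normcN w) le_normcD. Qed.

Lemma normc_distC z w : normc (z - w) = normc (w - z).
Proof. by rewrite -normcN opprB. Qed.

Lemma normc_sum I (r : seq I) (P : pred I) (F : I -> R[i]) :
  normc (\sum_(i <- r | P i) F i) <= \sum_(i <- r | P i) normc (F i).
Proof.
apply: (big_ind2 (fun z x => normc z <= x)) => //; first by rewrite normc0.
by move=> z x w y zx wy; apply: le_trans (le_normcD _ _) (lerD zx wy).
Qed.

Lemma Re_gauss_rule q a b (F : R -> R[i]) :
  complex.Re (gauss_rule q a b F) = real_gauss q a b (fun x => complex.Re (F x)).
Proof.
rewrite Re_mul /= mul0r subr0 Re_sum; congr (_ * _).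
by apply: eq_bigr => x _; rewrite Re_mul /= mul0r subr0.
Qed.

Lemma Im_gauss_rule q a b (F : R -> R[i]) :
  complex.Im (gauss_rule q a b F) = real_gauss q a b (fun x => complex.Im (F x)).
Proof.
rewrite Im_mul /= mul0r addr0 Im_sum; congr (_ * _).
by apply: eq_bigr => x _; rewrite Im_mul /= mul0r addr0.
Qed.

End ComplexParts.

(** * Quadrature error over a partition *)

Section QuadratureError.
Variable R : realType.
Local Notation mu := (@lebesgue_measure R).
Implicit Types (p : seq R) (F w : R -> R[i]) (A M B rho d : R).

(** Size at most [q.*2] means degree at most [2q - 1], the degree of exactness. Panels are open
    because [w] may jump at their ends. *)
Definition piecewise_poly q p w := forall i, (i < (size p).-1)%N ->
  exists W1 W2 : {poly R}, [/\ (size W1 <= q.*2)%N, (size W2 <= q.*2)%N &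
    forall x, p`_i < x < p`_i.+1 -> w x = (W1.[x] +i* W2.[x])%C].

Definition quad_error q p F : R[i] :=
  cintegral (head 0 p) (last 0 p) F -
  \sum_(i < (size p).-1) gauss_rule q p`_i p`_i.+1 F.

(** The real and the imaginary part of a complex product are each a sum of two real products, which
    are estimated separately. *)
Lemma panel_errorD q a b (f1 f2 : R -> R) e1 e2 :
  mu.-integrable `[a, b] (EFin \o f1) /\
    `|\int[mu]_(x in `[a, b]) f1 x - real_gauss q a b f1| <= e1 ->
  mu.-integrable `[a, b] (EFin \o f2) /\
    `|\int[mu]_(x in `[a, b]) f2 x - real_gauss q a b f2| <= e2 ->
  mu.-integrable `[a, b] (EFin \o (fun x => f1 x + f2 x)) /\
    `|\int[mu]_(x in `[a, b]) (f1 x + f2 x) -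
      real_gauss q a b (fun x => f1 x + f2 x)| <= e1 + e2.
Proof.
move=> [i1 h1] [i2 h2]; split; first exact: (integrableD _ i1 i2).
rewrite RintegralD // real_gaussD opprD addrACA.
exact: le_trans (ler_normD _ _) (lerD h1 h2).
Qed.

Lemma panels_error q p (f : R -> R) e : p != [::] -> sorted <%R p ->
  (forall i, (i < (size p).-1)%N ->
     mu.-integrable `[p`_i, p`_i.+1] (EFin \o f) /\
     `|\int[mu]_(x in `[p`_i, p`_i.+1]) f x - real_gauss q p`_i p`_i.+1 f|
       <= e * (p`_i.+1 - p`_i)) ->
  mu.-integrable `[head 0 p, last 0 p] (EFin \o f) /\
  `|\int[mu]_(x in `[head 0 p, last 0 p]) f x -
    \sum_(i < (size p).-1) real_gauss q p`_i p`_i.+1 f|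
    <= e * (last 0 p - head 0 p).
Proof.
case: p => // a s _ /= ps h.
have [i1 e1] := Rintegral_path_split ps (fun i hi => proj1 (h i hi)).
split => //; rewrite e1 -sumrB; apply: le_trans (ler_norm_sum _ _ _) _.
apply: (@le_trans _ _ (\sum_(i < size s) e * ((a :: s)`_i.+1 - (a :: s)`_i))).
  by apply: ler_sum => i _; exact: (proj2 (h i (ltn_ord i))).
rewrite -mulr_sumr -(big_mkord xpredT (fun i => (a :: s)`_i.+1 - (a :: s)`_i)).
by rewrite telescope_sumr // (last_nth 0).
Qed.

Lemma panel_lt p i : sorted <%R p -> (i < (size p).-1)%N -> p`_i < p`_i.+1.
Proof. by case: p => [|x s] //= /(pathP 0); apply. Qed.

Lemma panel_itv p i x : sorted <%R p -> (i < (size p).-1)%N ->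
  p`_i < x < p`_i.+1 -> x \in `]head 0 p, last 0 p[.
Proof.
move=> sp hi /andP[ix xi]; rewrite in_itv /=.
have hs : (i.+1 < size p)%N by case: (size p) hi.
have le_nth := sorted_leq_nth le_trans lexx 0 (sub_sorted (@ltW _ _) sp).
apply/andP; split.
  apply: le_lt_trans ix; rewrite -nth0; apply: le_nth => //; rewrite inE.
    exact: leq_ltn_trans hs.
  exact: ltnW.
apply: (lt_le_trans xi); rewrite -nth_last; apply: le_nth; rewrite ?inE //.
by case: (size p) hs.
Qed.

(* The integrability clauses serve to split the error of a difference. *)
Lemma quad_error_bound q p F w A M : p != [::] -> sorted <%R p ->
  (forall i, (i < (size p).-1)%N ->
     {within `[p`_i, p`_i.+1], continuous (fun x => complex.Re (F x))} /\
     {within `[p`_i, p`_i.+1], continuous (fun x => complex.Im (F x))}) ->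
  (forall i (x y : R), (i < (size p).-1)%N -> x \in `[p`_i, p`_i.+1] ->
     y \in `[p`_i, p`_i.+1] -> normc (F x - F y) <= A) ->
  piecewise_poly q p w ->
  (forall x, x \in `]head 0 p, last 0 p[ -> normc (w x) <= M) ->
  [/\ mu.-integrable `[head 0 p, last 0 p] (EFin \o (fun x => complex.Re (F x * w x))),
      mu.-integrable `[head 0 p, last 0 p] (EFin \o (fun x => complex.Im (F x * w x)))
    & normc (quad_error q p (fun x => F x * w x)) <=
       4 * gauss_const R q * (A * M) * (last 0 p - head 0 p)].
Proof.
move=> p0 sp cF hF pw hw.
(* The booleans [c] and [c'] choose the part of [F] and of [w], and [s] the sign, so that all four
   real products are covered by one argument. *)
have panel i : (i < (size p).-1)%N ->
    forall (c : bool) (f v : R -> R),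
    f = (fun x => if c then complex.Re (F x) else complex.Im (F x)) ->
    forall (c' s : bool),
    v = (fun x => (-1) ^+ s * (if c' then complex.Re (w x) else complex.Im (w x))) ->
    mu.-integrable `[p`_i, p`_i.+1] (EFin \o (fun x => f x * v x)) /\
    `|\int[mu]_(x in `[p`_i, p`_i.+1]) (f x * v x)
      - real_gauss q p`_i p`_i.+1 (fun x => f x * v x)|
     <= gauss_const R q * (A * M) * (p`_i.+1 - p`_i).
  move=> hi c f v -> c' s ->; have ab := panel_lt sp hi.
  have [W1 [W2 [s1 s2 hW]]] := pw i hi.
  apply: (@panel_error _ _ _ _ _ _ ((-1) ^+ s *: (if c' then W1 else W2))) => //.
  - by have [] := cF i hi; case: c.
  - move=> x y xp yp; apply: le_trans (hF i x y hi xp yp).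
    by case: c; rewrite -(Re_sub, Im_sub) (normRe_le, normIm_le).
  - by apply: leq_trans (size_scale_leq _ _) _; case: c'.
  - by move=> x; rewrite in_itv /= => /hW ->; rewrite hornerZ; case: c'.
  - move=> x xp; rewrite normrM normr_sign mul1r.
    apply: le_trans (hw x (panel_itv sp hi xp)).
    by case: c'; rewrite (normRe_le, normIm_le).
(* Two real products in each part, and two parts: this is the factor 4 of the statement. *)
pose K := gauss_const R q * (A * M) + gauss_const R q * (A * M).
have err f : (forall i, (i < (size p).-1)%N ->
     mu.-integrable `[p`_i, p`_i.+1] (EFin \o f) /\
     `|\int[mu]_(x in `[p`_i, p`_i.+1]) f x - real_gauss q p`_i p`_i.+1 f|
       <= gauss_const R q * (A * M) * (p`_i.+1 - p`_i) +
          gauss_const R q * (A * M) * (p`_i.+1 - p`_i)) ->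
  mu.-integrable `[head 0 p, last 0 p] (EFin \o f) /\
  `|\int[mu]_(x in `[head 0 p, last 0 p]) f x -
    \sum_(i < (size p).-1) real_gauss q p`_i p`_i.+1 f|
    <= K * (last 0 p - head 0 p).
  move=> h; apply: panels_error => // i hi; rewrite /K mulrDl; exact: h.
have [|iR eR] := err (fun x => complex.Re (F x * w x)).
  move=> i hi; have -> : (fun x => complex.Re (F x * w x)) = (fun x =>
      complex.Re (F x) * ((-1) ^+ false * complex.Re (w x)) +
      complex.Im (F x) * ((-1) ^+ true * complex.Im (w x))).
    by apply/funext => x; rewrite Re_mul /=; ring.
  apply: panel_errorD.
    exact: (panel i hi true _ _ erefl true false erefl).
  exact: (panel i hi false _ _ erefl false true erefl).
have [|iI eI] := err (fun x => complex.Im (F x * w x)).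
  move=> i hi; have -> : (fun x => complex.Im (F x * w x)) = (fun x =>
      complex.Re (F x) * ((-1) ^+ false * complex.Im (w x)) +
      complex.Im (F x) * ((-1) ^+ false * complex.Re (w x))).
    by apply/funext => x; rewrite Im_mul /=; ring.
  apply: panel_errorD.
    exact: (panel i hi true _ _ erefl false false erefl).
  exact: (panel i hi false _ _ erefl true false erefl).
split => //; apply: le_trans (normc_le_parts _) _.
rewrite /quad_error Re_sub Im_sub Re_sum Im_sum.
under eq_bigr do rewrite Re_gauss_rule.
under [X in _ + `|_ - X|]eq_bigr do rewrite Im_gauss_rule.
apply: le_trans (lerD eR eI) _; rewrite /K; lra.
Qed.

Lemma quad_errorB q p (F G : R -> R[i]) :
  let I := `[head 0 p, last 0 p]%classic in
  mu.-integrable I (EFin \o (fun x => complex.Re (F x))) ->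
  mu.-integrable I (EFin \o (fun x => complex.Im (F x))) ->
  mu.-integrable I (EFin \o (fun x => complex.Re (G x))) ->
  mu.-integrable I (EFin \o (fun x => complex.Im (G x))) ->
  quad_error q p (fun x => F x - G x) = quad_error q p F - quad_error q p G.
Proof.
move=> I rF iF rG iG; rewrite /quad_error.
have -> : \sum_(i < (size p).-1) gauss_rule q p`_i p`_i.+1 (fun x => F x - G x) =
    \sum_(i < (size p).-1) gauss_rule q p`_i p`_i.+1 F -
    \sum_(i < (size p).-1) gauss_rule q p`_i p`_i.+1 G.
  rewrite -sumrB; apply: eq_bigr => i _.
  rewrite /gauss_rule -mulrBr -sumrB; congr (_ * _).
  by apply: eq_bigr => x _; rewrite mulrBr.
have -> : cintegral (head 0 p) (last 0 p) (fun x => F x - G x) =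
    cintegral (head 0 p) (last 0 p) F - cintegral (head 0 p) (last 0 p) G.
  rewrite /cintegral; apply/eqP; rewrite eq_complex /=; apply/andP; split; apply/eqP.
  - by rewrite -RintegralB //; apply: eq_Rintegral => x _; rewrite Re_sub.
  - by rewrite -RintegralB //; apply: eq_Rintegral => x _; rewrite Im_sub.
ring.
Qed.

End QuadratureError.

(** * Cardinal splines *)

Section CardinalBSpline.
Variable R : realType.
Implicit Types (x y u : R) (m K : nat).
Local Notation N := (@cbspline_rec R).

Lemma cbspline_recS m x : N m.+1 x =
  ((m.+2%:R / 2 + x) * N m (x + 2^-1) + (m.+2%:R / 2 - x) * N m (x - 2^-1)) / m.+1%:R.
Proof. by []. Qed.

Lemma cbspline_rec0 x : N 0 x = (- 2^-1 <= x < 2^-1)%R%:R.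
Proof. by []. Qed.

(** [N m] has order [m.+1], hence this half-width of the support. The inequality is strict because
    [N 0] is 1 at its left end. *)
Lemma cbspline_rec_lt m x : x < - (m.+1%:R / 2) -> N m x = 0.
Proof.
elim: m x => [|m IH] x hx.
  by rewrite cbspline_rec0 (_ : (- 2^-1 <= x) = false) //; apply/negbTE; rewrite -ltNge; lra.
have e : m.+2%:R = m.+1%:R + 1 :> R by rewrite -[m.+2]addn1 natrD.
by rewrite cbspline_recS !IH ?mulr0 ?addr0 ?mul0r //; move: hx; rewrite e; lra.
Qed.

Lemma cbspline_rec_gt m x : m.+1%:R / 2 < x -> N m x = 0.
Proof.
elim: m x => [|m IH] x hx.
  rewrite cbspline_rec0 (_ : (x < 2^-1) = false) ?andbF //.
  by apply/negbTE; rewrite -leNgt; lra.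
have e : m.+2%:R = m.+1%:R + 1 :> R by rewrite -[m.+2]addn1 natrD.
by rewrite cbspline_recS !IH ?mulr0 ?addr0 ?mul0r //; move: hx; rewrite e; lra.
Qed.

Lemma cbspline_rec_supp m x : N m x != 0 -> - (m.+1%:R / 2) <= x <= m.+1%:R / 2.
Proof.
move=> nz; apply/andP; split; rewrite leNgt; apply: contraNN nz => hx.
  by rewrite cbspline_rec_lt.
by rewrite cbspline_rec_gt.
Qed.

Lemma cbspline_rec_bounded m : exists B : R, forall x, `|N m x| <= B.
Proof.
elim: m => [|m [B hB]].
  by exists 1 => x; rewrite cbspline_rec0; case: (_ && _); rewrite ?normr1 ?normr0.
have B0 : 0 <= B by apply: le_trans (hB 0).
(* On the support both factors of the recursion lie between 0 and [m.+2]. *)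
exists (2 * m.+2%:R * B) => x.
have [->|/cbspline_rec_supp hx] := eqVneq (N m.+1 x) 0.
  by rewrite normr0 !mulr_ge0.
have m1 : 1 <= m.+1%:R :> R by rewrite ler1n.
rewrite cbspline_recS normrM normfV [`|m.+1%:R|]ger0_norm // ler_pdivrMr ?ltr0n //.
apply: le_trans (ler_normD _ _) _; rewrite !normrM.
have := hB (x + 2^-1); have := normr_ge0 (N m (x + 2^-1)).
have := hB (x - 2^-1); have := normr_ge0 (N m (x - 2^-1)).
move: (`|N m (x - 2^-1)|) (`|N m (x + 2^-1)|) => p q p0 hp q0 hq.
rewrite !ger0_norm; [|lra|lra].
have : (m.+2%:R / 2 + x) * q <= m.+2%:R * B by apply: ler_pM => //; lra.
have : (m.+2%:R / 2 - x) * p <= m.+2%:R * B by apply: ler_pM => //; lra.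
have : 2 * m.+2%:R * B * 1 <= 2 * m.+2%:R * B * m.+1%:R.
  by apply: ler_wpM2l => //; rewrite !mulr_ge0.
lra.
Qed.

Lemma cbspline_rec_poly m (z : int) : exists2 P : {poly R}, (size P <= m.+1)%N &
  forall x, z%:~R + m.+1%:R / 2 < x < z%:~R + 1 + m.+1%:R / 2 -> N m x = P.[x].
Proof.
elim: m z => [|m IH] z.
  exists ((z == -1)%:R)%:P; first exact: size_polyC_leq1.
  move=> x hx; rewrite hornerC cbspline_rec0; congr (_%:R).
  have [zE|zN] := eqVneq z (-1).
    by move: hx; rewrite zE mulrN1z => hx; congr nat_of_bool; lra.
  suff -> : (- 2^-1 <= x < 2^-1) = false by [].
  apply/negbTE/negP => /andP[x1 x2].
  have z1 : z%:~R < 0 :> R by lra.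
  have z2 : (-2)%:~R < z%:~R :> R by lra.
  by move: z1 z2; rewrite ltrz0 ltr_int; lia.
have e : m.+2%:R = m.+1%:R + 1 :> R by rewrite -[m.+2]addn1 natrD.
(* The half-integer shifts map a knot interval of [N m.+1] onto knot intervals of [N m]: index
   [z + 1] for [x + 2^-1], index [z] for [x - 2^-1]. *)
have [P sP hP] := IH (z + 1); have [Q sQ hQ] := IH z.
pose l (c : R) : {poly R} := 'X + c%:P.
have sl c : size (l c) = 2 by rewrite size_XaddC.
pose T := m.+1%:R^-1 *: (('X + (m.+2%:R / 2)%:P) * (P \Po ('X + (2^-1)%:P)) +
  ((m.+2%:R / 2)%:P - 'X) * (Q \Po ('X + (- 2^-1)%:P))).
exists T.
  have sX : size ((m.+2%:R / 2)%:P - 'X : {poly R}) = 2%N.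
    by rewrite -opprB size_polyN size_XsubC.
  apply: leq_trans (size_scale_leq _ _) _; apply: leq_trans (size_polyD _ _) _.
  rewrite geq_max; apply/andP; split; apply: leq_trans (size_polyMleq _ _) _.
    by rewrite size_XaddC (size_comp_poly2 _ (size_XaddC _)).
  by rewrite sX (size_comp_poly2 _ (size_XaddC _)).
move=> x hx; rewrite cbspline_recS hP; last by rewrite intrD; lra.
rewrite hQ; last by lra.
by rewrite /T !hornerE !horner_comp !hornerE [RHS]mulrC (addrC x (_ / 2)).
Qed.

(** The hat function, the lowest order that is continuous. It starts the Lipschitz induction and the
    computation of the nodal values. *)
Lemma cbspline_rec1 u : N 1 u = Num.max 0 (1 - `|u|).
Proof.
have [u1|u1] := ltP u (-1).
  rewrite cbspline_rec_lt; last lra.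
  by rewrite max_l // ltr0_norm; lra.
have [u2|u2] := ltP 1 u.
  rewrite cbspline_rec_gt; last lra.
  by rewrite max_l // gtr0_norm; lra.
rewrite cbspline_recS !cbspline_rec0.
have [u0|u0] := ltP u 0.
  have -> : (- 2^-1 <= u + 2^-1 < 2^-1) by lra.
  rewrite (_ : (- 2^-1 <= u - 2^-1) = false); last by apply/negbTE; rewrite -ltNge; lra.
  by rewrite ltr0_norm // max_r /=; lra.
rewrite ger0_norm // max_r; last lra.
rewrite (_ : (u + 2^-1 < 2^-1) = false) ?andbF; last by apply/negbTE; rewrite -leNgt; lra.
have [u3|u3] := ltP u 1.
  have -> : (- 2^-1 <= u - 2^-1 < 2^-1) by lra.
  by rewrite /=; lra.
have -> : u = 1 by lra.
by rewrite (_ : (_ < _) = false) ?andbF /=; [lra|apply/negbTE; rewrite -leNgt; lra].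
Qed.

Lemma cbspline_rec_lip m : exists L : R, forall x y,
  `|N m.+1 x - N m.+1 y| <= L * `|x - y|.
Proof.
elim: m => [|m [L hL]].
  exists 1 => x y; rewrite mul1r !cbspline_rec1.
  apply: le_trans (ler_dist_dist x y); move: `|x| `|y| => a b.
  have := ler_norm (a - b); have := ler_norm (b - a); rewrite (distrC b a) ler_norml.
  by move: `|a - b| => D; case: (leP 0 (1 - a)); case: (leP 0 (1 - b)); lra.
have [B hB] := cbspline_rec_bounded m.+1.
have [B' hB'] := cbspline_rec_bounded m.+2.
have L0 : 0 <= L by have := hL 0 1; rewrite sub0r normrN1 mulr1; apply: le_trans.
have B0 : 0 <= B by apply: le_trans (hB 0).
have B'0 : 0 <= B' by apply: le_trans (hB' 0).
set k : R := m.+3%:R / 2.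
have k0 : 0 <= k by rewrite divr_ge0.
(* Near the support the factors of the recursion are at most [2 * k + 1], and each of its two
   products contributes [B + (2 * k + 1) * L]. The summand [B'] is for distant points. *)
exists (2 * (B + (2 * k + 1) * L) + B') => x y.
have C0 : 0 <= 2 * (B + (2 * k + 1) * L) by nra.
(* The factors of the recursion are unbounded on the line. But if [u] is this far out, either both
   values vanish or [v] is at distance more than 1 from [u], and boundedness is enough. *)
have far u v : k + 1 < `|u| -> `|N m.+2 u - N m.+2 v| <= B' * `|u - v|.
  move=> hu; have -> : N m.+2 u = 0.
    move: hu; rewrite lter_normr => /orP[hu|hu].
      by rewrite cbspline_rec_gt // -/k; lra.
    by rewrite cbspline_rec_lt // -/k; lra.
  have [->|/cbspline_rec_supp hv] := eqVneq (N m.+2 v) 0.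
    by rewrite subr0 normr0 mulr_ge0.
  rewrite sub0r normrN -[leLHS]mulr1; apply: ler_pM => //.
  have : `|v| <= k by rewrite ler_norml.
  by have := lerB_dist u v; lra.
have [kx|xk] := ltP (k + 1) `|x|.
  by apply: le_trans (far x y kx) _; rewrite ler_wpM2r // lerDr.
have [ky|yk] := ltP (k + 1) `|y|.
  by rewrite distrC (distrC x); apply: le_trans (far y x ky) _; rewrite ler_wpM2r // lerDr.
have part c d : `|c| <= k + 1 -> `|N m.+1 (x + d) - N m.+1 (y + d)| <= L * `|x - y| ->
  `|(k + c) * (N m.+1 (x + d) - N m.+1 (y + d))| <= (2 * k + 1) * (L * `|x - y|).
  move=> hc hd; rewrite normrM ler_pM //.
  by apply: le_trans (ler_normD _ _) _; rewrite ger0_norm //; lra.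
have m2 : 1 <= m.+2%:R :> R by rewrite ler1n.
rewrite !(cbspline_recS m.+1) -/k -mulrBl normrM normfV [`|m.+2%:R|]ger0_norm //.
rewrite ler_pdivrMr; last lra.
have -> : (k + x) * N m.+1 (x + 2^-1) + (k - x) * N m.+1 (x - 2^-1) -
    ((k + y) * N m.+1 (y + 2^-1) + (k - y) * N m.+1 (y - 2^-1)) =
  (x - y) * N m.+1 (x + 2^-1) + (y - x) * N m.+1 (x - 2^-1) +
  ((k + y) * (N m.+1 (x + 2^-1) - N m.+1 (y + 2^-1)) +
   (k + - y) * (N m.+1 (x - 2^-1) - N m.+1 (y - 2^-1))) by ring.
have hD d : `|N m.+1 (x + d) - N m.+1 (y + d)| <= L * `|x - y|.
  by apply: le_trans (hL _ _) _; rewrite (_ : x + d - (y + d) = x - y) //; ring.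
have h1 := part y 2^-1 yk (hD _).
have h2 : `|(k + - y) * (N m.+1 (x - 2^-1) - N m.+1 (y - 2^-1))| <=
    (2 * k + 1) * (L * `|x - y|) by apply: part; rewrite ?normrN.
have h3 : `|(x - y) * N m.+1 (x + 2^-1)| <= `|x - y| * B by rewrite normrM ler_wpM2l.
have h4 : `|(y - x) * N m.+1 (x - 2^-1)| <= `|x - y| * B.
  by rewrite normrM distrC ler_wpM2l.
apply: le_trans (ler_normD _ _) _.
apply: le_trans (lerD (ler_normD _ _) (ler_normD _ _)) _.
apply: le_trans (lerD (lerD h3 h4) (lerD h1 h2)) _.
have : 0 <= B' * `|x - y| by rewrite mulr_ge0.
have : 0 <= `|x - y| by [].
move: `|x - y| => D D0 BD.
rewrite -[leLHS]mulr1; apply: ler_pM => //; last lra.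
by rewrite !addr_ge0 // !mulr_ge0 //; lra.
Qed.

(** The two conditions ensure that every integer translate whose support contains [u] has its index
    among [0, ..., K - 1]. *)
Lemma cbspline_rec_unity m K u : m.+1%:R / 2 - 1 < u -> u + m.+1%:R / 2 < K%:R ->
  \sum_(i < K) N m (u - i%:R) = 1.
Proof.
elim: m u => [|m IH] u u1 u2.
  pose j := Num.truncn (u + 2^-1).
  have /andP[j1 j2] : j%:R <= u + 2^-1 < j.+1%:R by apply: truncn_itv; lra.
  have jK : (j < K)%N by rewrite -(ltr_nat R); lra.
  rewrite (bigD1 (Ordinal jK)) // big1 ?addr0.
    rewrite cbspline_rec0 /=; have {}j2 : u + 2^-1 < j%:R + 1 by rewrite natr1.
    by have -> : - 2^-1 <= u - j%:R < 2^-1; [lra|rewrite addr0].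
  move=> i ij; rewrite cbspline_rec0.
  suff -> : (- 2^-1 <= u - i%:R < 2^-1) = false by [].
  apply/negbTE/negP => /andP[i1 i2]; move/eqP: ij; apply; apply: val_inj => /=.
  have : (i%:R < j.+1%:R :> R) by lra.
  have : (j%:R < i.+1%:R :> R) by rewrite -[i.+1%:R]natr1; lra.
  by rewrite !ltr_nat; lia.
have e : m.+2%:R = m.+1%:R + 1 :> R by rewrite -[m.+2]addn1 natrD.
rewrite e in u1 u2.
(* [A i] is the first product in the recursion for the translate [i]; the second is [m.+1] times a
   translate of lower order, minus [A i.+1]. The sum telescopes, and [A 0] and [A K] vanish by the
   support. *)
pose A (i : nat) := (m.+2%:R / 2 + (u - i%:R)) * N m (u - i%:R + 2^-1).
have m0 : m.+1%:R != 0 :> R by rewrite pnatr_eq0.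
rewrite (eq_bigr (fun i : 'I_K => N m (u - 2^-1 - i%:R) - (A i.+1 - A i) / m.+1%:R)); last first.
  move=> i _; rewrite cbspline_recS /A e.
  have -> : u - i.+1%:R + 2^-1 = u - 2^-1 - i%:R by rewrite -natr1; lra.
  have -> : u - i%:R - 2^-1 = u - 2^-1 - i%:R by ring.
  by rewrite -natr1; field.
rewrite sumrB IH ?e; try lra.
rewrite -mulr_suml -(big_mkord xpredT (fun i => A i.+1 - A i)) telescope_sumr //.
rewrite /A cbspline_rec_lt; last lra.
by rewrite cbspline_rec_gt ?mulr0 ?subrr ?mul0r ?subr0 //; lra.
Qed.

End CardinalBSpline.

(** * The collocation system and the Hoelder modulus of a spline *)

Section SplineStability.
Variable R : realType.
Implicit Types (m n : nat) (c d : int -> R[i]) (z s : int) (x y r : R).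
Local Notation N := (@cbspline_rec R).

Lemma cbspline_rec1_0 y : 1 <= `|y| -> N 1 y = 0.
Proof. by move=> y1; rewrite cbspline_rec1 max_l // subr_le0. Qed.

Lemma cbspline_rec1_in y : `|y| <= 1 -> N 1 y = 1 - `|y|.
Proof. by move=> y1; rewrite cbspline_rec1 max_r // subr_ge0. Qed.

(** The values at -1, 0, 1 are 0, 1, 0 for order 2; 1/8, 3/4, 1/8 for order 3; 1/6, 2/3, 1/6 for
    order 4. The margins of dominance are 1, 1/2 and 1/3. *)
Lemma cbspline_nodes m : m \in [:: 2; 3; 4]%N -> exists2 b : R, 0 <= b &
  [/\ cbspline m (-2 : R) = 0, cbspline m (-1 : R) = b, cbspline m (1 : R) = b,
      cbspline m (2 : R) = 0 & 3^-1 <= cbspline m (0 : R) - 2 * b].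
Proof.
have n0 : N 1 0 = 1 by rewrite cbspline_rec1_in normr0; lra.
have np1 : N 1 1 = 0 by rewrite cbspline_rec1_0 // normr1.
have nm1 : N 1 (-1) = 0 by rewrite cbspline_rec1_0 // normrN1.
have nh y : `|y| = 2^-1 -> N 1 y = 2^-1 by move=> e; rewrite cbspline_rec1_in e; lra.
have nph : N 1 (2^-1) = 2^-1 by apply: nh; rewrite ger0_norm.
have nmh : N 1 (- 2^-1) = 2^-1 by apply: nh; rewrite normrN ger0_norm.
have far y : 1 < y \/ y < -1 -> N 1 y = 0.
  by case=> ?; [apply: cbspline_rec_gt|apply: cbspline_rec_lt]; lra.
have far2 y : 3/2 < y \/ y < -(3/2) -> N 2 y = 0.
  by case=> ?; [apply: cbspline_rec_gt|apply: cbspline_rec_lt]; lra.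
have q0 : N 2 0 = 3 / 4 by rewrite cbspline_recS add0r sub0r nph nmh; lra.
have qp1 : N 2 1 = 8^-1.
  rewrite cbspline_recS (far (1 + _)); last by left; lra.
  by rewrite (_ : 1 - 2^-1 = 2^-1) ?nph; lra.
have qm1 : N 2 (-1) = 8^-1.
  rewrite cbspline_recS (far (-1 - _)); last by right; lra.
  by rewrite (_ : -1 + 2^-1 = - 2^-1) ?nmh; lra.
have qph : N 2 (2^-1) = 2^-1.
  rewrite cbspline_recS subrr n0 (_ : 2^-1 + 2^-1 = 1) ?np1; lra.
have qmh : N 2 (- 2^-1) = 2^-1.
  rewrite cbspline_recS addNr n0 (_ : - 2^-1 - 2^-1 = - 1) ?nm1; lra.
have e32 : N 2 (3/2) = 0.
  rewrite cbspline_recS (far (_ + _)); last by left; lra.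
  by rewrite subrr; lra.
have em32 : N 2 (-(3/2)) = 0.
  rewrite cbspline_recS (far (_ - _)); last by right; lra.
  by rewrite addrN; lra.
rewrite !inE => /or3P[] /eqP ->; [change (@cbspline R 2) with (N 1)|
  change (@cbspline R 3) with (N 2)|change (@cbspline R 4) with (N 3)].
- exists 0 => //; split => //; rewrite ?n0; try lra.
  + by apply: far; right; lra.
  + by apply: far; left; lra.
- exists 8^-1 => //; split => //; rewrite ?q0; try lra.
  + by apply: far2; right; lra.
  + by apply: far2; left; lra.
- exists 6^-1 => //; split.
  + rewrite cbspline_recS (far2 (- 2 - _)); last by right; lra.
    by lra.
  + rewrite cbspline_recS (_ : -1 + 2^-1 = - 2^-1) ?qmh; last lra.
    by rewrite (_ : -1 - 2^-1 = - (3 / 2)) ?em32; lra.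
  + rewrite cbspline_recS (_ : 1 + 2^-1 = 3 / 2) ?e32; last lra.
    by rewrite (_ : 1 - 2^-1 = 2^-1) ?qph; lra.
  + rewrite cbspline_recS (_ : 2 - 2^-1 = 3 / 2) ?e32; last lra.
    by rewrite far2; [lra|left; lra].
  + rewrite cbspline_recS add0r sub0r qph qmh; lra.
Qed.

(* Strict diagonal dominance of the collocation matrix. *)
Lemma circulant_bound n c d (a b D : R) : (0 < n)%N ->
  (forall z k, c (z + k * n%:Z) = c z) -> 0 <= b -> 3^-1 <= a - 2 * b ->
  (forall z, b%:C%C * c (z - 1) + a%:C%C * c z + b%:C%C * c (z + 1) = d z) ->
  (forall z, normc (d z) <= D) -> forall z, normc (c z) <= 3 * D.
Proof.
move=> n0 pc b0 ab ec hD.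
(* By periodicity the modulus of [c] has a maximum, attained within one period. The equation there
   gives [(a - 2 * b) * F i <= D], whence the factor 3. *)
pose F (i : 'I_n) := normc (c (val i)%:Z).
case: (@arg_maxP _ _ _ (Ordinal n0) predT F isT) => i _ hi.
have nz : n%:Z != 0 by rewrite eqz_nat -lt0n.
have himax z : normc (c z) <= F i.
  have zn : (absz (z %% n)%Z < n)%N.
    by rewrite -ltz_nat gez0_abs ?modz_ge0 // ltz_pmod // ltz_nat.
  apply: le_trans (hi (Ordinal zn) isT); rewrite /F /= gez0_abs ?modz_ge0 //.
  by rewrite {1}(divz_eq z n) addrC pc.
suff hF : F i <= 3 * D by move=> z; exact: le_trans (himax z) hF.
have a0 : 0 <= a by lra.
have : a * F i <= D + b * F i + b * F i.
  have -> : a * F i = normc (a%:C%C * c (val i)%:Z).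
    by rewrite normcM normc_real ger0_norm.
  have -> : a%:C%C * c (val i)%:Z = d (val i)%:Z - b%:C%C * c ((val i)%:Z - 1) -
      b%:C%C * c ((val i)%:Z + 1) by rewrite -ec; ring.
  apply: le_trans (le_normcB _ _) _; apply: lerD.
    apply: le_trans (le_normcB _ _) _; apply: lerD => //.
    by rewrite normcM normc_real ger0_norm // ler_wpM2l.
  by rewrite normcM normc_real ger0_norm // ler_wpM2l.
have : 0 <= F i by exact: normc_ge0.
nra.
Qed.

Lemma circulant_diff n c d (a b : R) s D : (0 < n)%N ->
  (forall z k, c (z + k * n%:Z) = c z) -> 0 <= b -> 3^-1 <= a - 2 * b ->
  (forall z, b%:C%C * c (z - 1) + a%:C%C * c z + b%:C%C * c (z + 1) = d z) ->
  (forall z, normc (d (z + s) - d z) <= D) ->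
  forall z, normc (c (z + s) - c z) <= 3 * D.
Proof.
move=> n0 pc b0 ab ec hD.
apply: (@circulant_bound n (fun z => c (z + s) - c z)
  (fun z => d (z + s) - d z) a b D) => //.
- by move=> z k; rewrite addrAC !pc.
- by move=> z; rewrite -!ec [z - 1 + s]addrAC [z + 1 + s]addrAC; ring.
Qed.

Lemma cbspline_out m y : (m <= 4)%N -> 2 < `|y| -> cbspline m y = 0.
Proof.
move=> m4; have : (m.-1.+1%:R / 2 <= 2 :> R).
  by rewrite ler_pdivrMr // -natrM ler_nat; case: m m4.
rewrite lter_normr /cbspline => h /orP[y2|y2].
  by apply: cbspline_rec_gt; lra.
by apply: cbspline_rec_lt; lra.
Qed.

(** The six indices [f - 2, ..., f + 3] suffice for every [y] in [[f, f + 2[]. With [f] left free,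
    one window serves both a point and any point less than 1 to its right. *)
Definition window_sum m c (f : int) y : R[i] :=
  \sum_(i < 6) c (f - 2 + i%:Z) *
    (cbspline m (y - (f - 2 + i%:Z)%:~R))%:C%C.

Definition spline_window m c y : R[i] := window_sum m c (Num.floor y) y.

Lemma window_sumS m c f y : (m <= 4)%N -> (f + 1)%:~R <= y < (f + 2)%:~R ->
  window_sum m c (f + 1) y = window_sum m c f y.
Proof.
move=> m4; rewrite !intrD => yf.
rewrite /window_sum [LHS]big_ord_recr [RHS]big_ord_recl /=.
rewrite (_ : cbspline m _ = 0); last first.
  by apply: cbspline_out => //; rewrite lter_normr !(intrB, intrD); lra.
rewrite (_ : cbspline m _ = 0); last first.
  by apply: cbspline_out => //; rewrite lter_normr !(intrB, intrD); lra.
rewrite !mulr0 addr0 add0r; apply: eq_bigr => i _.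
have -> : f + 1 - 2 + i%:Z = f - 2 + (bump 0 i)%:Z by rewrite /bump leq0n add1n intS; ring.
by [].
Qed.

Lemma spline_window_shift m c y r : (m <= 4)%N -> 0 <= r < 1 ->
  spline_window m c (y + r) = window_sum m c (Num.floor y) (y + r).
Proof.
move=> m4 r01; have := floor_itv y; set f := Num.floor y => /andP[f1 f2].
have [rf|rf] := ltP (y + r) (f + 1)%:~R.
  by rewrite /spline_window (@floor_def _ _ f) //; apply/andP; split; lra.
have h : (f + 1)%:~R <= y + r < (f + 1 + 1)%:~R.
  by rewrite rf /=; move: f2; rewrite !intrD; lra.
rewrite /spline_window (floor_def h) window_sumS //.
by move: h; rewrite -addrA.
Qed.

Lemma spline_window_int m c y s :
  spline_window m c (y + s%:~R) = spline_window m (fun z => c (z + s)) y.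
Proof.
rewrite /spline_window floorDrz ?intrKfloor ?intr_int //.
apply: eq_bigr => i _; congr (c _ * (cbspline m _)%:C%C); [ring|].
by rewrite !(intrD, intrB); ring.
Qed.

Lemma window_unity m y r : m \in [:: 2; 3; 4]%N -> 0 <= r < 1 ->
  \sum_(i < 6) cbspline m (y + r - (Num.floor y - 2 + i%:Z)%:~R) = 1.
Proof.
move=> mI r01; have := floor_itv y; set f := Num.floor y => /andP[f1 f2].
rewrite intrD in f2.
rewrite -[RHS](@cbspline_rec_unity _ m.-1 6 (y + r - f%:~R + 2)).
- apply: eq_bigr => i _; rewrite /cbspline; congr cbspline_rec; rewrite !(intrD, intrB); ring.
- by move: mI; rewrite !inE => /or3P[] /eqP -> /=; lra.
- by move: mI; rewrite !inE => /or3P[] /eqP -> /=; lra.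
Qed.

Lemma spline_window_bounded m c (D B : R) y :
  (forall z, normc (c z) <= D) -> (forall y, `|cbspline m y| <= B) ->
  normc (spline_window m c y) <= 6 * (D * B).
Proof.
move=> hc hB; apply: le_trans (normc_sum _ _ _) _.
apply: (@le_trans _ _ (\sum_(i < 6) (D * B))).
  apply: ler_sum => i _; rewrite normcM normc_real.
  by apply: ler_pM => //; exact: normc_ge0.
by rewrite big_const_ord iter_addr_0 mulr_natl.
Qed.

Lemma spline_windowB m c c' y :
  spline_window m c y - spline_window m c' y =
  spline_window m (fun z => c z - c' z) y.
Proof. by rewrite -sumrB; apply: eq_bigr => i _; rewrite mulrBl. Qed.

(* Integer steps are translations of the coefficients; for the fractional part
   only differences of coefficients matter, by the partition of unity. *)
Lemma spline_window_holder m : m \in [:: 2; 3; 4]%N ->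
  exists2 C : R, 0 < C & forall c (A b : R), 0 < b <= 1 ->
    (forall z (s : nat), normc (c (z + s%:Z) - c z) <= A * s%:R `^ b) ->
    forall x y, normc (spline_window m c x - spline_window m c y)
      <= C * A * `|x - y| `^ b.
Proof.
move=> mI; have m4 : (m <= 4)%N by move: mI; rewrite !inE => /or3P[] /eqP ->.
have [B hB] := @cbspline_rec_bounded R m.-1.
have [L hL] : exists L, forall x y, `|cbspline m x - cbspline m y| <= L * `|x - y|.
  by move: mI; rewrite !inE => /or3P[] /eqP ->; exact: cbspline_rec_lip.
have B0 : 0 <= B by apply: le_trans (hB 0).
have L0 : 0 <= L by have := hL 0 1; rewrite sub0r normrN1 mulr1; apply: le_trans.
(* [6 * B] is for the integer part of the step. For the fractional part there are six terms, with
   index offsets at most 5 and Lipschitz constant [L], giving [30 * L]. *)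
exists (6 * B + 30 * L + 1); first lra.
move=> c A b /andP[b0 b1] hc.
have A0 : 0 <= A by have := hc 0 1%N; rewrite powR1 mulr1; apply: le_trans; exact: normc_ge0.
have main x u : 0 <= u -> normc (spline_window m c (x + u) - spline_window m c x)
    <= (6 * B + 30 * L) * A * u `^ b.
  move=> u0; pose s := Num.truncn u; pose r := u - s%:R.
  have /andP[s1 s2] : s%:R <= u < s.+1%:R by exact: truncn_itv.
  have r01 : 0 <= r < 1 by rewrite /r; move: s2; rewrite -natr1; lra.
  have -> : x + u = x + r + s%:Z%:~R by rewrite /r -pmulrn; ring.
  rewrite spline_window_int.
  rewrite -[X in normc X](subrKA (spline_window m c (x + r))) spline_windowB.
  apply: le_trans (le_normcD _ _) _.
  have -> : (6 * B + 30 * L) * A * u `^ b = 6 * (A * u `^ b * B) + 30 * L * A * u `^ b by ring.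
  apply: lerD.
    apply: spline_window_bounded => // z; apply: le_trans (hc z s) _.
    by rewrite ler_wpM2l // ge0_ler_powR // ?nnegrE ?ler0n //; lra.
  have r0 : 0 <= r < 1 by [].
  have xx : x = x + 0 by rewrite addr0.
  rewrite {2}xx !spline_window_shift //; last by lra.
  rewrite /window_sum -sumrB.
  set f := Num.floor x.
  (* The leftmost coefficient of the window is subtracted throughout; its multiples sum to zero by
     the partition of unity. *)
  rewrite (eq_bigr (fun i : 'I_6 => (c (f - 2 + i%:Z) - c (f - 2)) *
     (cbspline m (x + r - (f - 2 + i%:Z)%:~R) -
       cbspline m (x + 0 - (f - 2 + i%:Z)%:~R))%:C%C +
     c (f - 2) * (cbspline m (x + r - (f - 2 + i%:Z)%:~R) -
       cbspline m (x + 0 - (f - 2 + i%:Z)%:~R))%:C%C)); last first.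
    by move=> i _; rewrite rmorphB /=; ring.
  rewrite big_split /= -mulr_sumr -rmorph_sum /= sumrB !window_unity //; last by lra.
  rewrite subrr mulr0 addr0.
  apply: le_trans (normc_sum _ _ _) _.
  (* Since [r < 1] and [b <= 1], [r <= r^b], which is at most [u^b]. *)
  have rb : r <= u `^ b.
    have [r00|rn] := eqVneq r 0; first by rewrite r00 powR_ge0.
    apply: (@le_trans _ _ (r `^ b)).
      by rewrite -[leLHS]powRr1 ?ger_powR //; lra.
    by rewrite ge0_ler_powR // ?nnegrE /r; move: (ler0n R s); lra.
  apply: (@le_trans _ _ (\sum_(i < 6) (5 * A * (L * u `^ b)))).
    apply: ler_sum => i _; rewrite normcM normc_real; apply: ler_pM => //; first exact: normc_ge0.
      apply: le_trans (hc _ _) _; rewrite mulrC ler_wpM2r //.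
      have [->|i0] := posnP i; first by rewrite powR0 ?gt_eqF.
      apply: (@le_trans _ _ (i%:R `^ 1)).
        by rewrite ler_powR // ler1n.
      by rewrite powRr1 // ler_nat -ltnS.
    apply: le_trans (hL _ _) _; rewrite ler_wpM2l //.
    rewrite (_ : x + r - _ - _ = r); last by ring.
    by rewrite ger0_norm //; lra.
  by rewrite big_const_ord iter_addr_0 -mulr_natl; lra.
move=> x y; wlog xy : x y / y <= x.
  move=> hw; have [|/ltW] := leP y x; first exact: hw.
  by rewrite normc_distC distrC; exact: hw.
have -> : x = y + (x - y) by ring.
rewrite (_ : y + (x - y) - y = x - y); last by ring.
have xy0 : 0 <= x - y by lra.
rewrite (ger0_norm xy0); apply: le_trans (main y _ xy0) _.
by rewrite !ler_wpM2r ?powR_ge0 //; lra.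
Qed.

End SplineStability.

(** * Periodic splines on the contour as window sums *)

Section SplineRepresentation.
Variables (R : realType) (g : R -> R[i]).
Hypothesis gper : forall x, g (x + 2 * pi) = g x.
Hypothesis ginj : forall x y, 0 <= x < 2 * pi -> 0 <= y < 2 * pi -> g x = g y -> x = y.
Implicit Types (m n q : nat) (x y ph : R).

Lemma param_val x : 0 <= x < 2 * pi -> param g (g x) = x.
Proof.
move=> hx; rewrite /param; case: xgetP => [y _ [hy]|/(_ x)]; first exact: ginj.
by case.
Qed.

Lemma periodic_shift (z : int) x : g (x + 2 * pi * z%:~R) = g x.
Proof.
have nat_shift (k : nat) y : g (y + 2 * pi * k%:R) = g y.
  elim: k y => [|k IH] y; first by rewrite mulr0 addr0.
  by rewrite -[k.+1%:R]natr1 mulrDr mulr1 addrA gper IH.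
case: z => k; first exact: nat_shift.
by rewrite NegzE -(nat_shift k.+1 (_ + _)) mulrNz mulrN subrK.
Qed.

Lemma curve_param t : curve g t -> exists2 x, 0 <= x < 2 * pi & t = g x.
Proof.
case=> x _ <-; have p0 : 0 < 2 * pi :> R by rewrite mulr_gt0 ?pi_gt0.
pose z := Num.floor (x / (2 * pi)); exists (x - 2 * pi * z%:~R).
  have /andP[] := floor_itv (x / (2 * pi)).
  rewrite -/z intrD ler_pdivlMr // ltr_pdivrMr // => h1 h2.
  by apply/andP; split; lra.
by rewrite -mulrN -mulrNz periodic_shift.
Qed.

Lemma mesh_gt0 n : (0 < n)%N -> 0 < mesh R n.
Proof. by move=> n0; rewrite divr_gt0 ?ltr0n // mulr_gt0 ?pi_gt0. Qed.

(** [(x - ph) / mesh R n] lies strictly between -1 and [n], so for [l] outside -1, 0, 1 the argument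
    exceeds [n] in modulus and leaves the support. *)
Lemma bspline_sum m n ph (j : 'I_n) x : (m <= 4)%N -> (4 <= n)%N ->
  0 <= ph < mesh R n -> 0 <= x < 2 * pi ->
  bspline g m ph j (g x) = \sum_(l <- [:: -1; 0; 1 : int])
    cbspline m ((x - ph) / mesh R n - (j%:Z + l * n%:Z)%:~R).
Proof.
move=> m4 n4 hph hx; have n0 : (0 < n)%N by lia.
have h0 := mesh_gt0 n0.
rewrite /bspline param_val //.
have e (l : int) : (x - node ph j) / mesh R n - l%:~R * n%:R =
    (x - ph) / mesh R n - (j%:Z + l * n%:Z)%:~R.
  by rewrite /node intrD intrM -!pmulrn; field; rewrite gt_eqF.
rewrite (fsbigE [:: -1; 0; 1 : int]) //; last first.
  move=> l _ lr; rewrite e cbspline_out //.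
  have y1 : -1 < (x - ph) / mesh R n by rewrite ltr_pdivlMr //; lra.
  have y2 : (x - ph) / mesh R n < n%:R.
    rewrite ltr_pdivrMr // mulrC /mesh divfK; first by lra.
    by rewrite pnatr_eq0; lia.
  have jn : (j%:R <= n%:R - 1 :> R) by rewrite lerBrDr natr1 ler_nat.
  have j0 : 0 <= j%:R :> R by [].
  have n4' : 4 <= n%:R :> R by rewrite ler_nat.
  rewrite intrD intrM -!pmulrn lter_normr.
  have [l2|l2] := leP 2 l.
    apply/orP; right; have : 2 <= l%:~R :> R by rewrite (ler_int R 2 l).
    by nra.
  have {}l2 : l <= -2 by move: lr; rewrite !inE; lia.
  apply/orP; left; have : l%:~R <= -2 :> R by rewrite (ler_int R l (-2)).
  by nra.
by rewrite big_mkcond; apply: eq_bigr => l _; rewrite e in_setT.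
Qed.

(** Written as a sum of indicators, so that it can be matched with the sum over [j] in
    [spline_windowE] term by term. *)
Definition periodize n (n0 : (0 < n)%N) (c : 'I_n -> R[i]) (z : int) : R[i] :=
  \sum_(j < n) (if (z %% n%:Z)%Z == j%:Z then c j else 0).

Lemma spline_windowE m n ph (n0 : (0 < n)%N) (c : 'I_n -> R[i]) x :
  (m <= 4)%N -> (4 <= n)%N -> 0 <= ph < mesh R n -> 0 <= x < 2 * pi ->
  \sum_(j < n) c j * (bspline g m ph j (g x))%:C%C =
  spline_window m (periodize n0 c) ((x - ph) / mesh R n).
Proof.
move=> m4 n4 hph hx; have h0 := mesh_gt0 n0.
set y := (x - ph) / mesh R n.
have y1 : -1 < y by rewrite ltr_pdivlMr //; lra.
have y2 : y < n%:R.
  rewrite ltr_pdivrMr // mulrC /mesh divfK; first by lra.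
  by rewrite pnatr_eq0; lia.
set f := Num.floor y.
have fy := floor_itv y; rewrite -/f intrD in fy.
have f1 : -1 <= f by rewrite floor_ge_int ltW.
have f2 : f < n%:Z by rewrite floor_lt_int -pmulrn.
(* each nonzero term is found in the window around [y] *)
have inwin (z : int) : cbspline m (y - z%:~R) =
    \sum_(i < 6) (if f - 2 + i%:Z == z then cbspline m (y - (f - 2 + i%:Z)%:~R) else 0).
  have [[z1 z2]|zout] : (f - 2 <= z /\ z <= f + 3) \/ (z < f - 2 \/ f + 3 < z) by lia.
    have zi : (absz (z - f + 2)%R < 6)%N by lia.
    rewrite (bigD1 (Ordinal zi)) //= big1 ?addr0.
      by rewrite (_ : f - 2 + _ = z) ?eqxx //; lia.
    move=> i ij; case: eqP => // ez; case/eqP: ij; apply: val_inj => /=; lia.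
  rewrite cbspline_out //.
    by rewrite big1 // => i _; case: eqP => // ez; have := ltn_ord i; lia.
  rewrite lter_normr; apply/orP; case: zout => hz.
    left; have : z%:~R <= f%:~R - 3 :> R.
      by rewrite -[3]/(3%:~R) -intrB ler_int; lia.
    lra.
  right; have : f%:~R + 4 <= z%:~R :> R.
    by rewrite -[4]/(4%:~R) -intrD ler_int; lia.
  lra.
under eq_bigr => j _.
  rewrite bspline_sum // rmorph_sum mulr_sumr /=.
  under eq_bigr => l _.
    rewrite inwin rmorph_sum mulr_sumr /=.
    over.
  rewrite exchange_big /=; over.
rewrite exchange_big /= /spline_window /window_sum -/f; apply: eq_bigr => i _.
rewrite /periodize mulr_suml; apply: eq_bigr => j _.
set z := f - 2 + i%:Z; set V := cbspline _ _.
have z1 : - n%:Z <= z by rewrite /z; lia.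
have z2 : z < 2 * n%:Z by rewrite /z; have := ltn_ord i; lia.
have jn := ltn_ord j.
have nz : n%:Z != 0 by rewrite eqz_nat -lt0n.
have := divz_eq z n; have := modz_ge0 z nz; have := ltz_pmod z (n0 : 0 < n%:Z).
move: (z %/ n)%Z (z %% n)%Z => Q r r2 r1 zE.
(* The window lies in [[-n, 2n[], so the quotient [Q] is -1, 0 or 1: each [z] meets exactly one of
   the three periods kept in [bspline_sum]. *)
have eqj (l : int) : -1 <= l -> l <= 1 -> (z == j%:Z + l * n%:Z) = (Q == l) && (r == j%:Z).
  move=> l1 l2; apply/idP/andP => [/eqP zl|[/eqP <- /eqP <-]]; last by rewrite zE; lia.
  have : (Q - l) * n%:Z = j%:Z - r by rewrite mulrBl; lia.
  have [->|Ql] := eqVneq Q l; first by rewrite subrr mul0r; split => //; lia.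
  by nia.
have Q1 : Q = -1 \/ Q = 0 \/ Q = 1 by nia.
rewrite !big_cons big_nil !eqj //.
have [rj|rj] := eqVneq r j%:Z; last first.
  by rewrite !andbF rmorph0 !mulr0 !addr0 mul0r.
rewrite !andbT; case: Q1 => [->|[->|->]] /=; rewrite ?rmorph0 ?mulr0 ?addr0 ?add0r //.
Qed.

Lemma periodize_periodic n (n0 : (0 < n)%N) (c : 'I_n -> R[i]) z k :
  periodize n0 c (z + k * n%:Z) = periodize n0 c z.
Proof. by apply: eq_bigr => j _; rewrite addrC modzMDl. Qed.

End SplineRepresentation.

(** * Metric properties of the contour *)

Section ContourMetric.
Variable R : realType.
Implicit Types (f : R -> R) (x y u T M : R).

Lemma derivable_continuous f : (forall x, derivable f x 1) -> continuous f.
Proof. by move=> df x; apply/differentiable_continuous/derivable1_diffP. Qed.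

Lemma continuous_bounded_itv f T : 0 <= T -> continuous f ->
  exists M, forall x, 0 <= x <= T -> `|f x| <= M.
Proof.
move=> T0 cf; have [|c _ hc] := @EVT_max R (fun x => `|f x|) 0 T T0.
  by apply: continuous_subspaceT => x; apply: cvg_norm; exact: cf.
by exists `|f c| => x hx; apply: hc; rewrite in_itv.
Qed.

Lemma mean_value f a b : (forall x, derivable f x 1) -> a <= b ->
  exists2 c, a <= c <= b & f b - f a = derive1 f c * (b - a).
Proof.
move=> df ab.
have [||c] := @MVT_segment R f (derive1 f) a b ab.
- by move=> x _; rewrite derive1E; apply: derivableP.
- by apply: continuous_subspaceT; exact: derivable_continuous.
- by rewrite in_itv /= => hc e; exists c.
Qed.

(** The mean value theorem, used once and then twice. The first bound makes the contour Lipschitz;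
    the second controls short chords from below. *)
Lemma C2_estimates f T : 0 <= T -> is_C2 f -> exists2 M, 0 < M &
  forall x u, 0 <= x -> 0 <= u -> x + u <= T ->
    `|f (x + u) - f x| <= M * u /\
    `|f (x + u) - f x - derive1 f x * u| <= M * u ^+ 2.
Proof.
move=> T0 [d1 d2 c2].
have [M1 h1] := continuous_bounded_itv T0 (derivable_continuous d2).
have [M2 h2] := continuous_bounded_itv T0 c2.
have M10 : 0 <= M1 by apply: le_trans (h1 0 _); rewrite ?normr_ge0 // lexx.
have M20 : 0 <= M2 by apply: le_trans (h2 0 _); rewrite ?normr_ge0 // lexx.
exists (M1 + M2 + 1); first lra.
move=> x u x0 u0 xu.
have [|c hc ->] := @mean_value f x (x + u) d1; first lra.
rewrite (_ : x + u - x = u); last by ring.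
split.
  rewrite normrM (ger0_norm u0) ler_wpM2r //.
  have : `|derive1 f c| <= M1 by apply: h1; lra.
  lra.
have [|e he ec] := @mean_value (derive1 f) x c d2; first lra.
rewrite -mulrBl ec !normrM (ger0_norm u0) expr2 mulrA ler_wpM2r //.
have hD : `|derive1 (derive1 f) e| <= M2 by apply: h2; lra.
rewrite [`|c - x|]ger0_norm; last lra.
have := normr_ge0 (derive1 (derive1 f) e).
move: `|derive1 (derive1 f) e| hD => D hD D0.
by apply: ler_pM; lra.
Qed.

Variable g : R -> R[i].
Hypothesis gC : C2_contour g.
Let p x := complex.Re (g x).
Let q x := complex.Im (g x).

Let gper x : g (x + 2 * pi) = g x. Proof. by case: gC. Qed.
Let ginj x y : 0 <= x < 2 * pi -> 0 <= y < 2 * pi -> g x = g y -> x = y.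
Proof. by case: gC => _ _ _ h _; exact: h. Qed.
Let pi2 : 0 < 2 * pi :> R. Proof. by rewrite mulr_gt0 ?pi_gt0. Qed.

Lemma contour_reduce x : exists z : int, 0 <= x - 2 * pi * z%:~R < 2 * pi.
Proof.
exists (Num.floor (x / (2 * pi))).
have /andP[] := floor_itv (x / (2 * pi)).
rewrite intrD ler_pdivlMr // ltr_pdivrMr // => h1 h2.
by apply/andP; split; lra.
Qed.

Let shift z x : g (x - 2 * pi * z%:~R) = g x.
Proof. by rewrite -mulrN -mulrNz (periodic_shift gper). Qed.

Lemma contour_lipschitz : exists2 G : R, 0 < G &
  forall x y, normc (g x - g y) <= G * `|x - y|.
Proof.
have [[C2p C2q] _ _ _ _] := gC.
(* A base point in [[0, 2 pi[] and an increment of at most [2 pi] remain in [[0, 4 pi]]. *)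
have T0 : 0 <= 4 * pi :> R by rewrite mulr_ge0 ?pi_ge0.
have [M1 M10 h1] := C2_estimates T0 C2p.
have [M2 M20 h2] := C2_estimates T0 C2q.
exists (M1 + M2); first lra.
have base x u : 0 <= x -> 0 <= u -> x + u <= 4 * pi ->
    normc (g (x + u) - g x) <= (M1 + M2) * u.
  move=> x0 u0 xu; apply: le_trans (normc_le_parts _) _; rewrite Re_sub Im_sub mulrDl.
  by apply: lerD; [have [] := h1 x u x0 u0 xu|have [] := h2 x u x0 u0 xu].
move=> x y; wlog xy : x y / y <= x.
  move=> hw; have [|/ltW] := leP y x; first exact: hw.
  by rewrite normc_distC distrC; exact: hw.
rewrite ger0_norm; last lra.
have [z hz] := contour_reduce y.
have [sm|bg] := leP (x - y) (2 * pi).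
  rewrite -(shift z x) -(shift z y).
  have -> : x - 2 * pi * z%:~R = y - 2 * pi * z%:~R + (x - y) by ring.
  by apply: base; lra.
(* For parameters more than a period apart, reducing both to [[0, 2 pi[] shortens their distance. *)
have [z' hz'] := contour_reduce x.
rewrite -(shift z' x) -(shift z y).
move: (y - _) (x - _) hz hz' => y' x' hy hx.
apply: (@le_trans _ _ ((M1 + M2) * `|x' - y'|)); last first.
  by rewrite ler_wpM2l; [|lra|rewrite ler_norml; lra].
have [yx|/ltW xy'] := leP y' x'.
  by rewrite ger0_norm ?subr_ge0 // -[x' in X in X <= _](subrKC y' x'); apply: base; lra.
rewrite normc_distC distrC.
by rewrite ger0_norm ?subr_ge0 // -[y' in X in X <= _](subrKC x' y'); apply: base; lra.
Qed.

(** For short increments the nonvanishing derivative dominates the Taylor remainder; for the others,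
    compactness and injectivity give a positive minimum. The bound [u <= pi] excludes increments
    near [2 pi], where the curve closes up. *)
Lemma contour_chord : exists2 kap : R, 0 < kap &
  forall x u, 0 <= x <= 2 * pi -> 0 <= u <= pi ->
    kap * u <= normc (g (x + u) - g x).
Proof.
have [[C2p C2q] _ dg _ _] := gC.
have T0 : 0 <= 4 * pi :> R by rewrite mulr_ge0 ?pi_ge0.
have p0 : 0 < pi :> R := pi_gt0 R.
have [M1 M10 h1] := C2_estimates T0 C2p.
have [M2 M20 h2] := C2_estimates T0 C2q.
have half z : (`|complex.Re z| + `|complex.Im z|) / 2 <= normc (z : R[i]).
  by have := normRe_le z; have := normIm_le z; lra.
pose dp x := derive1 p x; pose dq x := derive1 q x.
have [[d1p d2p _] [d1q d2q _]] := (C2p, C2q).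
have [||c _ hc] := @EVT_min R (fun x => `|dp x| + `|dq x|) 0 (2 * pi).
- exact: ltW.
- apply: continuous_subspaceT => x; apply: cvgD; apply: cvg_norm.
    exact: derivable_continuous d2p x.
  exact: derivable_continuous d2q x.
set m1 := `|dp c| + `|dq c| in hc.
have m10 : 0 < m1.
  rewrite lt_def addr_ge0 // andbT paddr_eq0 // !normr_eq0.
  apply: contraNN (dg c) => /andP[/eqP a /eqP b].
  by rewrite /cderiv eq_complex /= -[derive1 _ c]/(dp c) a -[derive1 _ c]/(dq c) b eqxx.
(* Up to [de] the remainder uses at most half of the lower bound [m1] of the derivative. The other
   half is halved again by [half], whence [m1 / 4]. *)
pose de := Num.min (m1 / (2 * (M1 + M2))) pi.
have de0 : 0 < de by rewrite lt_min p0 divr_gt0 // mulr_gt0 //; lra.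
have near x u : 0 <= x <= 2 * pi -> 0 <= u <= de ->
    m1 / 4 * u <= normc (g (x + u) - g x).
  move=> hx hu.
  have up : u <= pi by move: hu; rewrite le_min => /and3P[].
  have um : (M1 + M2) * u <= m1 / 2.
    have : u <= m1 / (2 * (M1 + M2)) by move: hu; rewrite le_min => /and3P[].
    rewrite ler_pdivlMr; last by rewrite mulr_gt0 //; lra.
    by lra.
  have [|||_ e1] := h1 x u; try lra.
  have [|||_ e2] := h2 x u; try lra.
  apply: le_trans (half _); rewrite Re_sub Im_sub -/(p _) -/(p _) -/(q _) -/(q _).
  have u0 : 0 <= u by lra.
  have f1 : `|dp x * u| <= `|p (x + u) - p x| + M1 * u ^+ 2.
    rewrite -[dp x * u](subKr (p (x + u) - p x)); apply: le_trans (ler_normB _ _) _.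
    by rewrite lerD2l.
  have f2 : `|dq x * u| <= `|q (x + u) - q x| + M2 * u ^+ 2.
    rewrite -[dq x * u](subKr (q (x + u) - q x)); apply: le_trans (ler_normB _ _) _.
    by rewrite lerD2l.
  rewrite normrM (ger0_norm u0) in f1; rewrite normrM (ger0_norm u0) in f2.
  have f3 : m1 <= `|dp x| + `|dq x| by apply: hc; rewrite in_itv.
  have f4 : (M1 + M2) * u ^+ 2 <= m1 / 2 * u by rewrite expr2 mulrA ler_wpM2r.
  have f5 : m1 * u <= (`|dp x| + `|dq x|) * u by rewrite ler_wpM2r.
  lra.
pose F (z : R * R) := `|p (z.1 + z.2) - p z.1| + `|q (z.1 + z.2) - q z.1|.
pose A : set (R * R) := `[0, 2 * pi] `*` `[de, pi].
have cF : continuous F.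
  have cc f : continuous f -> continuous (fun z : R * R => `|f (z.1 + z.2) - f z.1|).
    move=> cf z; apply: cvg_norm; apply: cvgB.
      apply: (@continuous_comp _ _ _ (fun z : R * R => z.1 + z.2) f); last exact: cf.
      by apply: cvgD; [exact: cvg_fst|exact: cvg_snd].
    by apply: (@continuous_comp _ _ _ (fun z : R * R => z.1) f); [exact: cvg_fst|exact: cf].
  move=> z; apply: cvgD.
    exact: (cc p (derivable_continuous d1p) z).
  exact: (cc q (derivable_continuous d1q) z).
have cA : compact A by apply: compact_setX; exact: segment_compact.
have A0 : A !=set0.
  exists (0, pi); split; rewrite /= in_itv /= lexx ?andbT; first exact: ltW.
  by rewrite ge_min lexx orbT.
have [[x0 u0] /set_mem[/= hx0 hu0] hmin] := compact_EVT_min A0 cA (continuous_subspaceT cF).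
rewrite !in_itv /= in hx0 hu0.
have F0 : 0 < F (x0, u0).
  rewrite lt_def addr_ge0 // andbT paddr_eq0 // !normr_eq0 !subr_eq0 /=.
  apply/negP => /andP[/eqP e1 /eqP e2].
  have eg : g (x0 + u0) = g x0.
    by apply/eqP; rewrite eq_complex -/(p _) -/(p _) -/(q _) -/(q _) e1 e2 !eqxx.
  have [z1 hz1] := contour_reduce (x0 + u0); have [z2 hz2] := contour_reduce x0.
  have := ginj hz1 hz2; rewrite !shift => /(_ eg) e.
  (* By injectivity [u0] would be an integer multiple of [2 pi], impossible for a positive number
     not exceeding [pi]. *)
  have e' : u0 = 2 * pi * (z1 - z2)%:~R by rewrite intrB; lra.
  have : (0 < z1 - z2) && (z1 - z2 < 1).
    rewrite -(ltr_int R) -[_ < 1](ltr_int R).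
    rewrite -(pmulr_rgt0 _ pi2) -e' -(ltr_pM2l pi2) -e'.
    by rewrite mulr1; lra.
  by move: (z1 - z2); clear; lia.
exists (Num.min (m1 / 4) (F (x0, u0) / (2 * pi))).
  by rewrite lt_min !divr_gt0.
move=> x u hx hu.
have [ud|/ltW ud] := leP u de.
  apply: le_trans (near x u hx _); last by lra.
  by apply: ler_wpM2r; [lra|rewrite ge_min lexx].
apply: le_trans (half _); rewrite Re_sub Im_sub -/(p _) -/(p _) -/(q _) -/(q _).
apply: (@le_trans _ _ (F (x0, u0) / 2)); last first.
  rewrite ler_wpM2r //; apply: (hmin (x, u)); rewrite inE; split => /=; rewrite in_itv //=.
  by rewrite ud /=; lra.
apply: (@le_trans _ _ (F (x0, u0) / (2 * pi) * pi)); last first.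
  by rewrite invfM mulrA divfK ?gt_eqF.
apply: ler_pM; try lra.
  by rewrite le_min !divr_ge0 // ltW.
by rewrite ge_min lexx orbT.
Qed.

End ContourMetric.

(** * Error of the quadrature operator *)

Section PiecewisePolynomials.
Variables (R : realType) (g : R -> R[i]).
Hypothesis ginj : forall x y, 0 <= x < 2 * pi -> 0 <= y < 2 * pi -> g x = g y -> x = y.
Implicit Types (p : seq R) (x y ph : R).

Lemma panel_notin p i x : sorted <%R p -> (i < (size p).-1)%N -> x \in p ->
  x <= p`_i \/ p`_i.+1 <= x.
Proof.
move=> sp hi xp; have hs : (i.+1 < size p)%N by case: (size p) hi.
have le_nth := sorted_leq_nth le_trans lexx 0 (sub_sorted (@ltW _ _) sp).
have kp : (index x p < size p)%N by rewrite index_mem.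
rewrite -(nth_index 0 xp).
have [ki|ik] := leqP (index x p) i; [left|right]; apply: le_nth; rewrite ?inE //.
exact: ltnW.
Qed.

Section Spline.
Variables (nd : nat) (thd : 'I_nd -> R) (m n q : nat) (ph : R) (p : seq R).
Hypotheses (m0 : (0 < m)%N) (m4 : (m <= 4)%N) (n4 : (4 <= n)%N) (mq : (m <= q.*2)%N).
Hypothesis hph : 0 <= ph < mesh R n.
Hypothesis hp : panel_partition thd m n ph p.

Let n0 : (0 < n)%N. Proof. exact: leq_trans n4. Qed.
Let h0 : 0 < mesh R n := mesh_gt0 R n0.

Lemma panel_in_period i x : (i < (size p).-1)%N -> p`_i < x < p`_i.+1 -> 0 < x < 2 * pi.
Proof.
case: hp => sp h0p hl _ _ hi hx.
by have := panel_itv sp hi hx; rewrite in_itv /= h0p hl.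
Qed.

(** No breakpoint lies inside a panel, so the knot interval found at the midpoint contains the whole
    open panel. *)
Lemma panel_knot_interval i : (i < (size p).-1)%N -> exists z : int,
  forall x, p`_i < x < p`_i.+1 ->
    z%:~R + m%:R / 2 < (x - ph) / mesh R n < z%:~R + 1 + m%:R / 2.
Proof.
move=> hi; have [sp hp0 hpl _ hb] := hp.
have ab := panel_lt sp hi.
have nob (z : int) : ~ p`_i < breakpoint m n ph z < p`_i.+1.
  move=> hz; have z2 := panel_in_period hi hz.
  have : breakpoint m n ph z \in p by apply: hb; lra.
  by move=> /(panel_notin sp hi); lra.
pose x0 := (p`_i + p`_i.+1) / 2.
have hx0 : p`_i < x0 < p`_i.+1 by rewrite /x0; lra.
pose z := Num.floor ((x0 - ph) / mesh R n - m%:R / 2).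
have /andP[zl zr] := floor_itv ((x0 - ph) / mesh R n - m%:R / 2).
rewrite -/z in zl zr; rewrite intrD in zr.
have zl' : breakpoint m n ph z <= x0.
  have : z%:~R + m%:R / 2 <= (x0 - ph) / mesh R n by lra.
  by rewrite ler_pdivlMr // /breakpoint; lra.
have zr' : x0 < breakpoint m n ph (z + 1).
  have : (x0 - ph) / mesh R n < z%:~R + 1 + m%:R / 2 by lra.
  by rewrite ltr_pdivrMr // /breakpoint intrD; lra.
exists z => x hx; rewrite ltr_pdivlMr // ltr_pdivrMr //.
have b1 : breakpoint m n ph z <= p`_i.
  by rewrite leNgt; apply/negP => h; apply: (nob z); lra.
have b2 : p`_i.+1 <= breakpoint m n ph (z + 1).
  by rewrite leNgt; apply/negP => h; apply: (nob (z + 1)); lra.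
by move: b1 b2; rewrite /breakpoint intrD => b1 b2; apply/andP; split; lra.
Qed.

Lemma spline_piecewise_poly v : spline_space g m n ph v ->
  piecewise_poly q p (fun x => v (g x)).
Proof.
move=> [c hc] i hi; have [z hz] := panel_knot_interval hi.
have /choice[P hP] : forall z : int, exists P : {poly R}, (size P <= m)%N /\
    forall x, z%:~R + m%:R / 2 < x < z%:~R + 1 + m%:R / 2 -> cbspline m x = P.[x].
  move=> k; have [P sP hP] := @cbspline_rec_poly R m.-1 k.
  by rewrite prednK // in sP hP; exists P.
pose l (j : 'I_n) (k : int) : {poly R} :=
  (mesh R n)^-1 *: 'X - (ph / mesh R n + (j%:Z + k * n%:Z)%:~R)%:P.
(* Integer translations carry knots to knots: the translate by [j + k n] is given on the panel by
   the piece of index [z - (j + k n)]. *)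
pose Bj (j : 'I_n) : {poly R} :=
  \sum_(k <- [:: -1; 0; 1 : int]) (P (z - (j%:Z + k * n%:Z)) \Po l j k).
have sl j k : size (l j k) = 2%N.
  rewrite /l size_polyDl ?size_scale ?size_polyX ?invr_eq0 ?gt_eqF //.
  by rewrite size_polyN size_polyC; case: (_ != _).
have sB j : (size (Bj j) <= q.*2)%N.
  apply: leq_trans mq; apply: leq_trans (size_sum _ _ _) _.
  apply/bigmax_leqP_seq => k _ _; rewrite size_comp_poly2 //.
  by have [] := hP (z - (j%:Z + k * n%:Z)).
have eB j x : p`_i < x < p`_i.+1 -> bspline g m ph j (g x) = (Bj j).[x].
  move=> hx; have x01 := panel_in_period hi hx.
  rewrite bspline_sum //; last by lra.
  rewrite /Bj horner_sum; apply: eq_bigr => k _; rewrite horner_comp.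
  have [_ e] := hP (z - (j%:Z + k * n%:Z)).
  have hzx := hz x hx; rewrite e; last by rewrite intrB; lra.
  congr (_.[_]); rewrite /l !hornerE; ring.
exists (\sum_(j < n) complex.Re (c j) *: Bj j), (\sum_(j < n) complex.Im (c j) *: Bj j).
have sum_le (r : 'I_n -> R) : (size (\sum_(j < n) r j *: Bj j)%R <= q.*2)%N.
  apply: leq_trans (size_sum _ _ _) _; apply/bigmax_leqP => j _.
  exact: leq_trans (size_scale_leq _ _) _.
split => // x hx; rewrite hc; last by exists x.
apply/eqP; rewrite eq_complex /= Re_sum Im_sum !horner_sum; apply/andP; split; apply/eqP.
  by apply: eq_bigr => j _; rewrite Re_mul /= mulr0 subr0 hornerZ eB.
by apply: eq_bigr => j _; rewrite Im_mul /= mulr0 add0r hornerZ eB.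
Qed.

Lemma jump_part_piecewise_poly f : (0 < q)%N ->
  piecewise_poly q p (fun x => jump_part g thd f (g x)).
Proof.
move=> q0 i hi; have [sp hp0 hpl hth _] := hp.
(* [thd j] is a point of the partition, so on the open panel [thd j < x] is decided by the left
   end. *)
pose Gj j : {poly R} := ((thd j <= p`_i)%R%:R)%:P - (2 * pi)^-1 *: 'X.
have sG j : (size (Gj j) <= q.*2)%N.
  apply: (@leq_trans 2); last by case: (q) q0.
  apply: leq_trans (size_polyD _ _) _; rewrite geq_max size_polyN.
  rewrite (leq_trans (size_polyC_leq1 _)) //=.
  by apply: leq_trans (size_scale_leq _ _) _; rewrite size_polyX.
have eG j x : p`_i < x < p`_i.+1 -> gen_G g thd j (g x) = (Gj j).[x].
  move=> hx; have x01 := panel_in_period hi hx.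
  rewrite /gen_G /gen_H /gen_R param_val //; last by lra.
  rewrite !hornerE [(2 * pi)^-1 * x]mulrC; congr ((nat_of_bool _)%:R - _).
  by have [|] := panel_notin sp hi (hth j); lra.
exists (\sum_(j < nd) complex.Re (jump g thd f j) *: Gj j),
  (\sum_(j < nd) complex.Im (jump g thd f j) *: Gj j).
have sum_le (r : 'I_nd -> R) : (size (\sum_(j < nd) r j *: Gj j)%R <= q.*2)%N.
  apply: leq_trans (size_sum _ _ _) _; apply/bigmax_leqP => j _.
  exact: leq_trans (size_scale_leq _ _) _.
split => // x hx.
apply/eqP; rewrite eq_complex /= Re_sum Im_sum !horner_sum; apply/andP; split; apply/eqP.
  by apply: eq_bigr => j _; rewrite Re_mul /= mulr0 subr0 hornerZ eG.
by apply: eq_bigr => j _; rewrite Im_mul /= mulr0 add0r hornerZ eG.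
Qed.

End Spline.
End PiecewisePolynomials.

(** * Pointwise form of the extended-real Hoelder norms *)

Section HolderNorms.
Variables (R : realType) (g : R -> R[i]).
Implicit Types (v : R[i] -> R[i]) (s t : R[i]) (A B b : R).

Lemma normc_gt0 t s : t != s -> 0 < normc (t - s).
Proof.
move=> ts; rewrite lt_def normc_ge0 andbT; apply: contraNN ts => /eqP.
by move=> /eq0_normc /eqP; rewrite subr_eq0.
Qed.

Lemma sup_norm_ge v t : curve g t -> ((normc (v t))%:E <= sup_norm g v)%E.
Proof. by move=> gt; apply: ereal_sup_ubound; exists t. Qed.

Lemma sup_norm_ge0 v : (0 <= sup_norm g v)%E.
Proof.
apply: le_trans (sup_norm_ge v (ex_intro2 _ _ 0 I erefl : curve g (g 0))).
by rewrite lee_fin normc_ge0.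
Qed.

Definition holder_seminorm b v : \bar R :=
  ereal_sup [set y | exists t u, [/\ curve g t, curve g u, t != u
     & y = (normc (v t - v u) / normc (t - u) `^ b)%:E]].

Lemma holder_norm_le b v A : 0 <= A ->
  (forall t, curve g t -> normc (v t) <= A) ->
  (forall t s, curve g t -> curve g s -> normc (v t - v s) <= A * normc (t - s) `^ b) ->
  (holder_norm g b v <= (2 * A)%:E)%E.
Proof.
move=> A0 h1 h2; rewrite mulr_natl mulr2n EFinD; apply: leeD; apply: ge_ereal_sup.
  by move=> _ [t gt <-]; rewrite lee_fin; exact: h1.
move=> _ [t [s [gt gs ts ->]]]; rewrite lee_fin ler_pdivrMr; first exact: h2.
by rewrite powR_gt0 // normc_gt0.
Qed.

Hypothesis g_ne : g 0 != g pi.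

(** Two distinct points of the curve make the set nonempty; the supremum of the empty set would be
    [-oo]. *)
Lemma holder_seminorm_ge0 b v : (0 <= holder_seminorm b v)%E.
Proof.
apply: (@le_trans _ _ ((normc (v (g 0) - v (g pi)) / normc (g 0 - g pi) `^ b)%:E)).
  by rewrite lee_fin divr_ge0 ?powR_ge0 ?normc_ge0.
by apply: ereal_sup_ubound; exists (g 0), (g pi); split; [exists 0|exists pi| |].
Qed.

Lemma sup_norm_le_holder_norm b v : (sup_norm g v <= holder_norm g b v)%E.
Proof. by apply: leeDl; exact: holder_seminorm_ge0. Qed.

Lemma holder_norm_val b v A : (holder_norm g b v <= A%:E)%E ->
  (forall t, curve g t -> normc (v t) <= A) /\
  (forall t s, curve g t -> curve g s -> normc (v t - v s) <= A * normc (t - s) `^ b).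
Proof.
move=> hA; split=> [t gt|t s gt gs].
  rewrite -lee_fin; apply: le_trans (le_trans (sup_norm_le_holder_norm b v) hA).
  exact: sup_norm_ge.
have [->|ts] := eqVneq t s.
  rewrite !subrr normc0; rewrite mulr_ge0 ?powR_ge0 //.
  by rewrite -lee_fin; apply: le_trans hA; apply: adde_ge0;
    [exact: sup_norm_ge0|exact: holder_seminorm_ge0].
rewrite -ler_pdivrMr; last by rewrite powR_gt0 // normc_gt0.
rewrite -lee_fin; apply: le_trans hA.
apply: (@le_trans _ _ (holder_seminorm b v)).
  by apply: ereal_sup_ubound; exists t, s.
by apply: leeDr; exact: sup_norm_ge0.
Qed.

End HolderNorms.

Section QuadratureOperator.
Variables (R : realType) (g : R -> R[i]) (k : R[i] -> R[i] -> R[i]).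
Variables (mu rho L : R) (q : nat).
Hypotheses (rho0 : 0 < rho) (L0 : 0 < L) (g_ne : g 0 != g pi).
Hypothesis hL : forall x y : R, 0 <= x <= 2 * pi -> 0 <= y <= 2 * pi ->
  (holder_norm g mu (fun t => akernel g k t x - akernel g k t y)%R
    <= (L * `|x - y| `^ rho)%:E)%E.

Lemma holder_continuous_itv (f : R -> R) (a b B : R) :
  (forall x y, x \in `[a, b] -> y \in `[a, b] -> `|f x - f y| <= B * `|x - y| `^ rho) ->
  {within `[a, b], continuous f}.
Proof.
move=> hf; apply/subspace_continuousP => x xab.
apply/cvgrPdist_le => e e0.
pose d := (e / (`|B| + 1)) `^ rho^-1.
have B1 : 0 < `|B| + 1 by rewrite ltr_wpDl.
have d0 : 0 < d by rewrite powR_gt0 // divr_gt0.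
rewrite near_withinE; apply/nbhs_ballP; exists d => //= y.
rewrite /ball /= => xy yab.
apply: le_trans (hf _ _ xab yab) _.
have : `|x - y| `^ rho <= e / (`|B| + 1).
  have -> : e / (`|B| + 1) = d `^ rho.
    by rewrite /d -powRrM mulVf ?gt_eqF // powRr1 // divr_ge0 // ltW.
  by rewrite ge0_ler_powR ?nnegrE // ltW.
rewrite ler_pdivlMr // => h.
apply: le_trans (_ : `|B| * `|x - y| `^ rho <= e).
  by rewrite ler_wpM2r ?powR_ge0 // ler_norm.
by have := powR_ge0 `|x - y| rho; lra.
Qed.

Lemma akernel_lip t x y : curve g t -> 0 <= x <= 2 * pi -> 0 <= y <= 2 * pi ->
  normc (akernel g k t x - akernel g k t y) <= L * `|x - y| `^ rho.
Proof. by move=> gt hx hy; have [h _] := holder_norm_val g_ne (hL hx hy); exact: h. Qed.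

(** Regrouped, the mixed difference is the increment from [s] to [t] of the function whose [H_mu]
    norm [hL] bounds. *)
Lemma akernel_diff_lip t s x y : curve g t -> curve g s ->
  0 <= x <= 2 * pi -> 0 <= y <= 2 * pi ->
  normc ((akernel g k t x - akernel g k s x) - (akernel g k t y - akernel g k s y))
   <= L * normc (t - s) `^ mu * `|x - y| `^ rho.
Proof.
move=> gt gs hx hy; have [_ h] := holder_norm_val g_ne (hL hx hy).
by rewrite mulrAC; apply: le_trans (h t s gt gs); rewrite [leLHS](_ : _ = normc
  (akernel g k t x - akernel g k t y - (akernel g k s x - akernel g k s y))) //;
  congr normc; ring.
Qed.

Variables (p : seq R) (d M : R) (v : R[i] -> R[i]).
Hypotheses (sp : sorted <%R p) (p_head : head 0 p = 0) (p_last : last 0 p = 2 * pi).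
Hypothesis hd : forall i, (i < (size p).-1)%N -> p`_i.+1 - p`_i <= d.
Hypothesis pv : piecewise_poly q p (fun x => v (g x)).
Hypothesis hM : forall t, curve g t -> normc (v t) <= M.

Let E t := Kop g k v t - Kquad g k q p v t.

Let p_neq0 : p != [::].
Proof.
apply: contra_eq_neq p_last => ->; rewrite /= eq_sym gt_eqF //.
by rewrite mulr_gt0 ?pi_gt0.
Qed.

(** Stated for a general [F], to be applied both to the kernel at a point and to a difference of
    kernels. *)
Let quad_bound (F : R -> R[i]) (B : R) : 0 <= B ->
  (forall x y, 0 <= x <= 2 * pi -> 0 <= y <= 2 * pi ->
     normc (F x - F y) <= B * `|x - y| `^ rho) ->
  [/\ lebesgue_measure.-integrable `[head 0 p, last 0 p]
        (EFin \o (fun x => complex.Re (F x * v (g x)))),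
      lebesgue_measure.-integrable `[head 0 p, last 0 p]
        (EFin \o (fun x => complex.Im (F x * v (g x))))
    & normc (quad_error q p (fun x => F x * v (g x))) <=
       4 * gauss_const R q * (B * d `^ rho * M) * (2 * pi)].
Proof.
move=> B0 hF.
have inI i x : (i < (size p).-1)%N -> x \in `[p`_i, p`_i.+1] -> 0 <= x <= 2 * pi.
  move=> hi; rewrite in_itv /=; have hs : (i.+1 < size p)%N by case: (size p) hi.
  have le_nth := sorted_leq_nth le_trans lexx 0 (sub_sorted (@ltW _ _) sp).
  have : 0 <= p`_i.
    have : p`_0 <= p`_i.
      by apply: le_nth; rewrite ?inE //; [exact: leq_ltn_trans hs|exact: ltnW].
    by rewrite nth0 p_head.
  have : p`_i.+1 <= 2 * pi.
    by rewrite -p_last -nth_last; apply: le_nth; rewrite ?inE //; case: (size p) hs.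
  lra.
have := @quad_error_bound R q p F (fun x => v (g x)) (B * d `^ rho) M p_neq0 sp.
rewrite p_head p_last subr0; apply.
- move=> i hi; split; apply: (@holder_continuous_itv _ _ _ B) => x y xi yi;
    apply: le_trans (hF x y (inI i x hi xi) (inI i y hi yi)).
    by rewrite -Re_sub; exact: normRe_le.
  by rewrite -Im_sub; exact: normIm_le.
- move=> i x y hi xi yi; apply: le_trans (hF x y (inI i x hi xi) (inI i y hi yi)) _.
  apply: ler_wpM2l => //; have := hd hi; have := panel_lt sp hi.
  move: xi yi; rewrite !in_itv /= => xi yi h1 h2.
  have hxy : `|x - y| <= d by rewrite ler_norml; lra.
  by rewrite ge0_ler_powR ?nnegrE //; [exact: ltW|exact: le_trans hxy].
- exact: pv.
- by move=> x _; apply: hM; exists x.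
Qed.

Let EE t : E t = quad_error q p (fun x => akernel g k t x * v (g x)).
Proof. by rewrite /quad_error p_head p_last. Qed.

Lemma quad_operator_sup t : curve g t ->
  normc (E t) <= 4 * gauss_const R q * (L * d `^ rho * M) * (2 * pi).
Proof.
move=> gt; rewrite EE.
have [|//] := @quad_bound (akernel g k t) L (ltW L0).
by move=> x y; exact: akernel_lip.
Qed.

Lemma quad_operator_diff t s : curve g t -> curve g s -> normc (E t - E s) <=
  4 * gauss_const R q * (L * d `^ rho * M) * (2 * pi) * normc (t - s) `^ mu.
Proof.
move=> gt gs; rewrite !EE.
have [|r1 i1 _] := @quad_bound (akernel g k t) L (ltW L0).
  by move=> x y; exact: akernel_lip.
have [|r2 i2 _] := @quad_bound (akernel g k s) L (ltW L0).
  by move=> x y; exact: akernel_lip.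
rewrite -quad_errorB //.
have := @quad_bound (fun x => akernel g k t x - akernel g k s x)
  (L * normc (t - s) `^ mu).
case=> [||_ _].
- by rewrite mulr_ge0 ?powR_ge0 // ltW.
- by move=> x y hx hy; exact: akernel_diff_lip.
have -> : (fun x => (akernel g k t x - akernel g k s x) * v (g x)) =
    (fun x => akernel g k t x * v (g x) - akernel g k s x * v (g x)).
  by apply/funext => x; rewrite mulrBl.
by move=> h; apply: le_trans h _; rewrite le_eqVlt; apply/orP; left; apply/eqP; ring.
Qed.

End QuadratureOperator.

(** * Stability of spline interpolation *)

Section InterpolationStability.
Variables (R : realType) (g : R -> R[i]) (m : nat) (mu beta : R).
Hypotheses (gC : C2_contour g) (mI : m \in [:: 2; 3; 4]%N).
Hypotheses (beta0 : 0 < beta) (beta_mu : beta < mu) (mu1 : mu <= 1).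

Let gper x : g (x + 2 * pi) = g x. Proof. by case: gC. Qed.
Let ginj x y : 0 <= x < 2 * pi -> 0 <= y < 2 * pi -> g x = g y -> x = y.
Proof. by case: gC => _ _ _ h _; exact: h. Qed.
Let m4 : (m <= 4)%N. Proof. by move: mI; rewrite !inE => /or3P[] /eqP ->. Qed.

(* On the integers the window reduces to the three-term collocation stencil. *)
Lemma spline_window_node (b : R) c z :
  cbspline m (-2 : R) = 0 -> cbspline m (-1 : R) = b -> cbspline m (1 : R) = b ->
  cbspline m (2 : R) = 0 ->
  spline_window m c z%:~R =
  b%:C%C * c (z - 1) + (cbspline m 0)%:C%C * c z + b%:C%C * c (z + 1).
Proof.
move=> e1 e2 e3 e4; rewrite /spline_window intrKfloor /window_sum.
have e (i : nat) : z%:~R - (z - 2 + i%:Z)%:~R = 2 - i%:R :> R.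
  by rewrite intrD intrB -pmulrn; ring.
rewrite !big_ord_recr big_ord0 /= !e add0r (subr0 (2 : R)) e4.
rewrite (_ : 2 - 1 = 1 :> R); last by ring.
rewrite (_ : 2 - 2 = 0 :> R); last by ring.
rewrite (_ : 2 - 3 = -1 :> R); last by ring.
rewrite (_ : 2 - 4 = -2 :> R); last by ring.
rewrite (cbspline_out (y := 2 - 5)) //; last by rewrite lter_normr; lra.
rewrite e1 e2 e3 rmorph0 !mulr0 add0r !addr0.
rewrite (_ : z - 2 + 1%:Z = z - 1); last by ring.
rewrite (_ : z - 2 + 2%:Z = z); last by ring.
rewrite (_ : z - 2 + 3%:Z = z + 1); last by ring.
by rewrite ![c _ * _]mulrC.
Qed.

(** [D] is fixed before [n], the phase and the data, which is the uniformity in [h]. *)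
Definition interp_const_spec (D : R) := forall n ph (u w : R[i] -> R[i]) A,
  (4 <= n)%N -> 0 <= ph < mesh R n -> spline_space g m n ph w ->
  (forall i : 'I_n, w (g (node ph i)) = u (g (node ph i))) ->
  (forall t, curve g t -> normc (u t) <= A) ->
  (forall t s, curve g t -> curve g s -> normc (u t - u s) <= A * normc (t - s) `^ mu) ->
  (forall t, curve g t -> normc (w t) <= D * A) /\
  (forall t s, curve g t -> curve g s -> normc (w t - w s) <= D * A * normc (t - s) `^ beta).

Lemma interp_stable : exists2 D : R, 1 <= D & interp_const_spec D.
Proof.
have [G G0 hG] := contour_lipschitz gC.
have [kap k0 hk] := contour_chord gC.
have [b b0 [e1 e2 e3 e4 hab]] := cbspline_nodes R mI.
have [Cm C0 hC] := spline_window_holder R mI.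
have [B hB] := @cbspline_rec_bounded R m.-1.
have B0 : 0 <= B by apply: le_trans (hB 0).
have pi0 := pi_gt0 R.
(* [G * (2 * pi)] bounds the diameter of the contour, so [D1] is the cost of lowering the exponent
   from [mu] to [beta]. *)
pose D1 := (G * (2 * pi)) `^ (mu - beta).
have D10 : 0 <= D1 by exact: powR_ge0.
(* In the maximum norm: six window terms bounded by [B], and 3 for the inverse collocation matrix.
   In the seminorm: the same 3, with [G / kap] from comparing parameter distances and chords. *)
pose D := 18 * B + 3 * Cm * D1 * (G / kap) `^ beta + 1.
have Gk : 0 <= (G / kap) `^ beta by exact: powR_ge0.
have p1 : 0 <= 3 * Cm * D1 * (G / kap) `^ beta.
  by rewrite !mulr_ge0 // ltW.
exists D; first by rewrite /D; lra.
move=> n ph u w A n4 hph [c0 hc0] hw hu hud.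
have n0 : (0 < n)%N by exact: leq_trans n4.
have h0 := mesh_gt0 R n0.
have nh : n%:R * mesh R n = 2 * pi by rewrite mulrC divfK // pnatr_eq0 -lt0n.
have A0 : 0 <= A by apply: le_trans (hu (g 0) _); [exact: normc_ge0|exists 0].
pose c := periodize n0 c0.
pose d (z : int) := u (g (ph + z%:~R * mesh R n)).
have pc z l : c (z + l * n%:Z) = c z by exact: periodize_periodic.
have pd z l : d (z + l * n%:Z) = d z.
  rewrite /d -[in RHS](periodic_shift gper l) -nh; congr (u (g _)).
  by rewrite intrD intrM -pmulrn; ring.
have wE x : 0 <= x < 2 * pi -> w (g x) = spline_window m c ((x - ph) / mesh R n).
  by move=> hx; rewrite hc0 ?spline_windowE //; exists x.
(* Interpolation gives the equations at the [n] nodes; periodicity extends them to all integers. A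
   phase below [mesh R n] keeps the nodes in [[0, 2 pi[]. *)
have collocation z :
    b%:C%C * c (z - 1) + (cbspline m 0)%:C%C * c z + b%:C%C * c (z + 1) = d z.
  have nz : n%:Z != 0 by rewrite eqz_nat -lt0n.
  have := divz_eq z n; have := modz_ge0 z nz; have := ltz_pmod z (n0 : 0 < n%:Z).
  move: (z %/ n)%Z (z %% n)%Z => l r r2 r1 ->.
  have -> : l * n%:Z + r - 1 = r - 1 + l * n%:Z by ring.
  have -> : l * n%:Z + r + 1 = r + 1 + l * n%:Z by ring.
  rewrite [l * _ + r]addrC !pc pd.
  have rn : (absz r < n)%N by rewrite -ltz_nat gez0_abs.
  have hi := hw (Ordinal rn).
  have ei : node ph (Ordinal rn) = ph + r%:~R * mesh R n.
    by rewrite /node /= -{2}(gez0_abs r1) -pmulrn.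
  rewrite ei wE in hi; last first.
    have : 0 <= r%:~R :> R by rewrite ler0z.
    have : r%:~R + 1 <= n%:R :> R.
      by rewrite [n%:R]pmulrn -[1]/(1%:~R) -intrD ler_int; move: r2; clear; lia.
    by move=> ? ?; rewrite -nh; nra.
  rewrite (_ : (ph + r%:~R * mesh R n - ph) / mesh R n = r%:~R) in hi; last first.
    by field; rewrite gt_eqF.
  by rewrite /d -hi (spline_window_node c r e1 e2 e3 e4).
have hudb t s : curve g t -> curve g s ->
    normc (u t - u s) <= A * D1 * normc (t - s) `^ beta.
  move=> gt gs; apply: le_trans (hud t s gt gs) _.
  rewrite -mulrA; apply: ler_wpM2l => //.
  have -> : mu = (mu - beta) + beta by ring.
  have [->|ts] := eqVneq t s.
    have mu0 : 0 < mu := lt_trans beta0 beta_mu.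
    by rewrite subrr normc0 !powR0 ?mulr0 ?gt_eqF // subrK.
  rewrite powRD; last by rewrite (gt_eqF (normc_gt0 ts)) implybT.
  apply: ler_wpM2r; first exact: powR_ge0.
  apply: ge0_ler_powR; rewrite ?nnegrE ?normc_ge0 ?subr_ge0 //; first exact: ltW.
    by rewrite !mulr_ge0 // ltW.
  have [x hx ->] := curve_param gper gt; have [y hy ->] := curve_param gper gs.
  apply: le_trans (hG x y) _; apply: ler_wpM2l; first exact: ltW.
  by rewrite ler_norml; lra.
have hd (s : nat) z : normc (d (z + s%:Z) - d z) <=
    A * D1 * ((G * mesh R n) `^ beta * s%:R `^ beta).
  apply: le_trans (hudb _ _ _ _) _; try by eexists.
  apply: ler_wpM2l; first exact: mulr_ge0.
  have Gm : 0 <= G * mesh R n by rewrite mulr_ge0 // ltW.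
  rewrite -powRM //; apply: ge0_ler_powR; rewrite ?nnegrE ?normc_ge0 //; first exact: ltW.
    by rewrite mulr_ge0.
  apply: le_trans (hG _ _) _; rewrite -mulrA; apply: ler_wpM2l; first exact: ltW.
  rewrite intrD mulrDl -pmulrn (_ : _ - _ = s%:R * mesh R n); last by ring.
  by rewrite ger0_norm; [rewrite mulrC|rewrite mulr_ge0 // ltW].
have hcd z (s : nat) : normc (c (z + s%:Z) - c z) <=
    3 * (A * D1 * (G * mesh R n) `^ beta) * s%:R `^ beta.
  rewrite -!mulrA; apply: (circulant_diff n0 pc b0 hab collocation).
  by move=> z'; rewrite (mulrA A); exact: hd.
have beta1 : 0 < beta <= 1 by rewrite beta0 (le_trans (ltW beta_mu)).
have hWd := hC c _ beta beta1 hcd.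
(* The factor [(mesh R n)^beta] in the coefficient differences cancels the scaling of the parameter,
   and the bound is free of [n]. *)
have stepW x y : normc (spline_window m c ((x - ph) / mesh R n) -
    spline_window m c ((y - ph) / mesh R n)) <=
    3 * Cm * D1 * A * (G * `|x - y|) `^ beta.
  apply: le_trans (hWd _ _) _.
  have Gm : 0 <= G * mesh R n by rewrite mulr_ge0 // ltW.
  rewrite (_ : Cm * _ * _ = 3 * Cm * D1 * A * ((G * mesh R n) `^ beta *
    `|(x - ph) / mesh R n - (y - ph) / mesh R n| `^ beta)); last by ring.
  rewrite -powRM // (_ : G * mesh R n * _ = G * `|x - y|) //.
  rewrite -mulrBl normrM normfV (gtr0_norm h0) (_ : x - ph - (y - ph) = x - y); last by ring.
  by field; rewrite gt_eqF.
have cper y : spline_window m c (y + n%:R) = spline_window m c y.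
  rewrite (_ : n%:R = (n%:Z)%:~R :> R) // spline_window_int.
  by congr spline_window; apply/funext => z; rewrite -[n%:Z]mul1r pc.
have chordW t s u' : 0 <= u' -> kap * u' <= normc (t - s) ->
    3 * Cm * D1 * A * (G * u') `^ beta <= D * A * normc (t - s) `^ beta.
  move=> u0 hu'; apply: (@le_trans _ _
      (3 * Cm * D1 * (G / kap) `^ beta * A * normc (t - s) `^ beta)); last first.
    apply: ler_wpM2r; first exact: powR_ge0.
    by apply: ler_wpM2r => //; rewrite /D; lra.
  rewrite (_ : 3 * Cm * D1 * (G / kap) `^ beta * A * normc (t - s) `^ beta =
    3 * Cm * D1 * A * ((G / kap) `^ beta * normc (t - s) `^ beta)); last by ring.
  have Gk1 : 0 <= G / kap by rewrite divr_ge0 // ltW.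
  apply: ler_wpM2l; first by rewrite !mulr_ge0 // ltW.
  rewrite -powRM ?normc_ge0 //; apply: ge0_ler_powR; rewrite ?nnegrE //; first exact: ltW.
  - by rewrite mulr_ge0 // ltW.
  - by rewrite mulr_ge0 // normc_ge0.
  rewrite -mulrA; apply: ler_wpM2l; first exact: ltW.
  by rewrite mulrC ler_pdivlMr // mulrC.
split=> [t gt|].
  have [x hx ->] := curve_param gper gt; rewrite wE //.
  have hcb := circulant_bound n0 pc b0 hab collocation (fun z => hu _ (ex_intro2 _ _ _ I erefl)).
  apply: le_trans (spline_window_bounded _ hcb hB) _.
  rewrite (_ : 6 * (3 * A * B) = 18 * B * A); last by ring.
  by apply: ler_wpM2r => //; rewrite /D; lra.
have ordered x y : 0 <= x < 2 * pi -> 0 <= y < 2 * pi -> y <= x ->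
    normc (w (g x) - w (g y)) <= D * A * normc (g x - g y) `^ beta.
  move=> hx hy yx; rewrite !wE //.
  have [xy|xy] := leP (x - y) pi.
    apply: le_trans (stepW _ _) _; apply: chordW => //.
    rewrite ger0_norm ?subr_ge0 //.
    have := hk y (x - y); rewrite (_ : y + (x - y) = x); last by ring.
    by apply; lra.
  (* Beyond [pi] the contour is traversed the other way round, from [x] to [y + 2 pi]. *)
  have -> : spline_window m c ((y - ph) / mesh R n) =
      spline_window m c ((y + 2 * pi - ph) / mesh R n).
    rewrite -(cper ((y - ph) / _)); congr spline_window.
    by rewrite -nh; field; rewrite gt_eqF.
  apply: le_trans (stepW _ _) _; rewrite distrC.
  have u0 : 0 <= y + 2 * pi - x by lra.
  apply: chordW => //; rewrite ger0_norm //.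
  have := hk x (y + 2 * pi - x); rewrite (_ : x + (y + 2 * pi - x) = y + 2 * pi); last by ring.
  by rewrite gper normc_distC; apply; lra.
move=> t s gt gs.
have [x hx ->] := curve_param gper gt; have [y hy ->] := curve_param gper gs.
have [yx|/ltW xy] := leP y x; first exact: ordered.
by rewrite normc_distC (normc_distC (g x)); exact: ordered.
Qed.

End InterpolationStability.

(** * Operator estimates with one constant *)

Section QuadratureOperatorNorm.
Variables (R : realType) (g : R -> R[i]) (k : R[i] -> R[i] -> R[i]).
Variables (m q : nat) (mu beta rho L CPi D : R).
Hypotheses (gC : C2_contour g) (rho0 : 0 < rho) (L0 : 0 < L) (D1 : 1 <= D).
Hypothesis hL : forall x y : R, 0 <= x <= 2 * pi -> 0 <= y <= 2 * pi ->
  (holder_norm g mu (fun t => akernel g k t x - akernel g k t y)%R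
    <= (L * `|x - y| `^ rho)%:E)%E.
Hypothesis hD : interp_const_spec g m mu beta D.

Lemma contour_antipode : g 0 != g pi.
Proof.
case: gC => _ _ _ inj _; have p0 := pi_gt0 R.
apply/eqP => /inj e; have : 0 = pi :> R by apply: e; lra.
lra.
Qed.

(** The 2 is for the two summands of the norm. [D] is for interpolation and, being at least 1,
    covers the bound without [P_h] too. The final 1 makes the constant positive, so that its product
    with an infinite norm is infinite. *)
Definition quad_operator_const : R :=
  2 * D * (4 * gauss_const R q * (L * `|CPi| `^ rho) * (2 * pi)) + 1.

Lemma quad_operator_const_gt0 : 0 < quad_operator_const.
Proof.
have gc0 : 0 <= gauss_const R q by apply: le_trans (gauss_const_ge1 R q).
have K0 : 0 <= 4 * gauss_const R q * (L * `|CPi| `^ rho) * (2 * pi).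
  by rewrite !mulr_ge0 ?powR_ge0 ?pi_ge0 // ltW.
by rewrite /quad_operator_const ltr_wpDl // mulr_ge0 // mulr_ge0 // (le_trans ler01 D1).
Qed.

Variables (n : nat) (ph : R) (p : seq R) (v : R[i] -> R[i]).
Hypotheses (n4 : (4 <= n)%N) (hph : 0 <= ph < mesh R n).
Hypotheses (sp : sorted <%R p) (p_head : head 0 p = 0) (p_last : last 0 p = 2 * pi).
Hypothesis hd : forall i, (i < (size p).-1)%N -> p`_i.+1 - p`_i <= CPi * mesh R n.
Hypothesis pv : piecewise_poly q p (fun x => v (g x)).

Let E t := Kop g k v t - Kquad g k q p v t.

Lemma quad_operator_norm :
  (holder_norm g mu E <= (quad_operator_const * mesh R n `^ rho)%:E * sup_norm g v)%E /\
  (holder_norm g beta (spline_interp g m n ph E)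
     <= (quad_operator_const * mesh R n `^ rho)%:E * sup_norm g v)%E.
Proof.
have h0 : 0 < mesh R n by apply: mesh_gt0; exact: leq_trans n4.
have gc0 : 0 <= gauss_const R q by apply: le_trans (gauss_const_ge1 R q).
have hr0 : 0 < mesh R n `^ rho by exact: powR_gt0.
pose K := 4 * gauss_const R q * (L * `|CPi| `^ rho) * (2 * pi).
have K0 : 0 <= K.
  by rewrite !mulr_ge0 ?powR_ge0 ?pi_ge0 // ltW.
have Ch0 : 0 < quad_operator_const * mesh R n `^ rho by rewrite mulr_gt0 ?quad_operator_const_gt0.
have := sup_norm_ge0 g v; case e : (sup_norm g v) => [M| |] // M0; last first.
  by rewrite gt0_muley ?lte_fin // !leey.
rewrite lee_fin in M0.
have hM t : curve g t -> normc (v t) <= M.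
  by move=> gt; rewrite -lee_fin -e; exact: sup_norm_ge.
have hd' i : (i < (size p).-1)%N -> p`_i.+1 - p`_i <= `|CPi| * mesh R n.
  by move=> /hd; have := ler_norm CPi; nra.
pose A := K * mesh R n `^ rho * M.
have A0 : 0 <= A by apply: mulr_ge0 => //; apply: mulr_ge0 => //; exact: ltW.
have eA : 4 * gauss_const R q * (L * (`|CPi| * mesh R n) `^ rho * M) * (2 * pi) = A.
  by rewrite /A /K powRM // ?ltW //; ring.
have hs t : curve g t -> normc (E t) <= A.
  rewrite -eA.
  exact: (quad_operator_sup rho0 L0 contour_antipode hL sp p_head p_last hd' pv hM).
have hds t s : curve g t -> curve g s -> normc (E t - E s) <= A * normc (t - s) `^ mu.
  rewrite -eA.
  exact: (quad_operator_diff rho0 L0 contour_antipode hL sp p_head p_last hd' pv hM).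
(* Used with [B = 1] for the [H_mu] bound and with [B = D] after interpolation. *)
have final (B : R) : B <= D -> 2 * (B * A) <= quad_operator_const * mesh R n `^ rho * M.
  move=> BD; rewrite /quad_operator_const -/K.
  have : B * A <= D * A by rewrite ler_wpM2r.
  have : 0 <= mesh R n `^ rho * M by rewrite mulr_ge0 // ltW.
  by rewrite /A; lra.
rewrite -EFinM; split.
  apply: le_trans (holder_norm_le A0 hs hds) _.
  by rewrite lee_fin -[A]mul1r final.
have DA0 : 0 <= D * A by rewrite mulr_ge0 // (le_trans ler01 D1).
apply: le_trans (_ : _ <= (2 * (D * A))%:E)%E _; last by rewrite lee_fin final.
(* Without an interpolating spline [spline_interp] would be the zero function,
   so that existence need not be proved. *)
rewrite /spline_interp; case: xgetP => [w _ [wS wi]|_].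
  have [h1 h2] := hD n4 hph wS wi hs hds.
  exact: holder_norm_le.
apply: holder_norm_le => // [t _|t s _ _]; rewrite ?subrr normc0 //.
by rewrite mulr_ge0 ?powR_ge0.
Qed.

End QuadratureOperatorNorm.

Theorem proposition10p2 (R : realType) (g : R -> R[i])
    (nd : nat) (thd : 'I_nd -> R) (k : R[i] -> R[i] -> R[i])
    (beta alpha mu rho Lrho eta0 CPi : R) (m q : nat)
    (phase : nat -> R) (panels : nat -> seq R) :
  C2_contour g -> jump_params thd ->
  0 < beta -> beta < alpha -> alpha < mu -> mu <= 1 ->
  kernel_regular g k mu ->
  m \in [:: 2; 3; 4]%N ->
  0 < eta0 < (2 * nd%:R)^-1 ->
  (forall n, (4 <= n)%N -> 0 <= phase n < mesh R n /\
     forall j (z : int), eta0 * mesh R n <= `|thd j - phase n - z%:~R * mesh R n|) ->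
  0 < rho <= 1 -> 0 < Lrho ->
  (forall x y : R, 0 <= x <= 2 * pi -> 0 <= y <= 2 * pi ->
     (holder_norm g mu (fun t => akernel g k t x - akernel g k t y)%R
        <= (Lrho * `|x - y| `^ rho)%:E)%E) ->
  (forall n, (4 <= n)%N -> panel_partition thd m n (phase n) (panels n)) ->
  (forall n, (4 <= n)%N -> forall i, (i < (size (panels n)).-1)%N ->
     (panels n)`_i.+1 - (panels n)`_i <= CPi * mesh R n) ->
  (uphalf m <= q)%N ->
  exists C : R, forall n, (4 <= n)%N ->
    let S := spline_space g m n (phase n) in
    let P := spline_interp g m n (phase n) in
    let E := fun v t => (Kop g k v t - Kquad g k q (panels n) v t)%R in
    let J := jump_part g thd in
    [/\ forall v, S v ->
          (holder_norm g mu (E v) <= (C * mesh R n `^ rho)%:E * sup_norm g v)%E,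
        forall f, PH g thd alpha f ->
          (holder_norm g mu (E (J f))
             <= (C * mesh R n `^ rho)%:E * sup_norm g (J f))%E,
        forall v, S v ->
          (holder_norm g beta (P (E v))
             <= (C * mesh R n `^ rho)%:E * holder_norm g beta v)%E
      & forall f, PH g thd alpha f ->
          (holder_norm g beta (P (E (J f)))
             <= (C * mesh R n `^ rho)%:E * sup_norm g (J f))%E].
Proof.
move=> gC hth b0 ba am m1 _ mI _ hph /andP[rho0 _] L0 hL hpan hlen mq.
have bm := lt_trans ba am.
have [D D1 hD] := interp_stable gC mI b0 bm m1.
have m_pos : (0 < m)%N by move: mI; rewrite !inE => /or3P[] /eqP ->.
have m4 : (m <= 4)%N by move: mI; rewrite !inE => /or3P[] /eqP ->.
(* [uphalf m] is the ceiling of [m / 2]; spline pieces of degree [m - 1] are therefore within the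
   exactness of the rule. *)
have m2q : (m <= q.*2)%N by move: mI mq; rewrite !inE => /or3P[] /eqP -> /=; lia.
have q0 : (0 < q)%N by lia.
have ginj : forall x y, 0 <= x < 2 * pi -> 0 <= y < 2 * pi -> g x = g y -> x = y.
  by case: gC.
exists (quad_operator_const q rho Lrho CPi D) => n n4 S P E J.
have [hph' _] := hph n n4.
have [sp p_head p_last _ _] := hpan n n4.
have est v : piecewise_poly q (panels n) (fun x => v (g x)) ->
    (holder_norm g mu (E v) <=
      (quad_operator_const q rho Lrho CPi D * mesh R n `^ rho)%:E * sup_norm g v)%E /\
    (holder_norm g beta (P (E v)) <=
      (quad_operator_const q rho Lrho CPi D * mesh R n `^ rho)%:E * sup_norm g v)%E.
  exact: (quad_operator_norm gC rho0 L0 D1 hL hD n4 hph' sp p_head p_last (hlen n n4)).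
have C0 : (0 <= (quad_operator_const q rho Lrho CPi D * mesh R n `^ rho)%:E)%E.
  by rewrite lee_fin mulr_ge0 ?powR_ge0 // ltW // quad_operator_const_gt0.
have spl v : S v -> piecewise_poly q (panels n) (fun x => v (g x)).
  exact: (spline_piecewise_poly ginj m_pos m4 n4 m2q hph' (hpan n n4)).
have jmp f : piecewise_poly q (panels n) (fun x => J f (g x)).
  exact: (jump_part_piecewise_poly ginj (hpan n n4) f q0).
split.
- by move=> v /spl hv; have [] := est v hv.
- by move=> f _; have [] := est _ (jmp f).
- move=> v /spl hv; have [_ h] := est v hv.
  apply: le_trans h _; apply: lee_wpmul2l => //.
  exact: sup_norm_le_holder_norm (contour_antipode gC) _ _.
- by move=> f _; have [] := est _ (jmp f).
Qed.
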